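(* Let $K$ be a differential field of characteristic $0$ with $m$ commuting derivations, let $V\subseteq\mathbb A^n$ be a differential algebraic variety over $K$ of dimension $d$, and let $\bar a\in\mathbb A^n$. Let $H_1,\dots,H_{d+1}$ be independent generic hyperplanes through $\bar a$, i.e. $H_j=\{\bar y:\sum_{i=1}^n c_{j,i}(y_i-a_i)=0\}$ where the family $(c_{j,i})_{j\le d+1,\,i\le n}$ consists of independent differential transcendentals over $K\langle\bar a\rangle$. If $V\cap H_1\cap\dots\cap H_{d+1}\neq\emptyset$, then $\bar a\in V$.
   Context: Points are taken in a large differentially closed field extending $K$. The dimension of a differential algebraic variety over $K$ is the differential transcendence degree over $K$ of the differential field generated by a generic point (for a variety with several $K$-irreducible components, the maximum over its components). *)

(* Defs.v *)
From HB Require Import structures.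
From mathcomp Require Import all_boot all_order all_algebra.
From mathcomp Require Import finmap.
From mathcomp.multinomials Require Import monalg.
From mathcomp Require Import boolp classical_sets functions cardinality.

Set Implicit Arguments.
Unset Strict Implicit.
Unset Printing Implicit Defensive.

Import GRing.Theory.

Local Open Scope classical_set_scope.
Local Open Scope ring_scope.

HB.mixin Record Field_isDiffField (m : nat) F of GRing.Field F := {
  der : 'I_m -> F -> F;
  derD : forall i x y, der i (x + y) = der i x + der i y;
  derM : forall i x y, der i (x * y) = der i x * y + x * der i y;
  der_comm : forall i j x, der i (der j x) = der j (der i x)
}.

#[short(type="diffFieldType")]
HB.structure Definition DiffField (m : nat) :=
  {F of GRing.Field F & Field_isDiffField m F}.

Definition diff_morphism (m : nat) (F L : diffFieldType m) (f : F -> L) : Prop :=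
  forall i x, f (der i x) = der i (f x).

Definition dern (m : nat) (F : diffFieldType m) (e : {ffun 'I_m -> nat}) (x : F) : F :=
  foldr (fun i => iter (e i) (der i)) x (enum 'I_m).

(* The differential polynomial ring F{y_i : i in I}: the polynomial ring in the
   indeterminates (i, e), where (i, e) stands for dern e y_i. *)
Definition dpoly (m : nat) (F : diffFieldType m) (I : choiceType) :=
  {malg F[cmonom (I * {ffun 'I_m -> nat})%type]}.

Definition dmonom_eval (m : nat) (L : diffFieldType m) (I : choiceType) (x : I -> L)
    (k : cmonom (I * {ffun 'I_m -> nat})%type) : L :=
  \prod_(v <- finsupp k) dern v.2 (x v.1) ^+ k v.

Definition deval (m : nat) (F L : diffFieldType m) (f : F -> L) (I : choiceType)
    (x : I -> L) (P : dpoly F I) : L :=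
  mmap f (dmonom_eval x) P.

Definition diff_closed (m : nat) (U : diffFieldType m) : Prop :=
  forall (n : nat) (s t : seq (dpoly U 'I_n)) (L : diffFieldType m)
    (f : {rmorphism U -> L}), diff_morphism f ->
  (exists x : 'I_n -> L, (forall P, P \in s -> deval f x P = 0) /\
                         (forall Q, Q \in t -> deval f x Q != 0)) ->
  exists x : 'I_n -> U, (forall P, P \in s -> deval idfun x P = 0) /\
                        (forall Q, Q \in t -> deval idfun x Q != 0).

Section Universe.
Variables (m : nat) (U : diffFieldType m).
Implicit Types (k E : set U).

Definition dpoly_over k (I : choiceType) (P : dpoly U I) : Prop :=
  forall u, k P@_u.

(* |T|^+-saturation. Only quantifier-free formulas are considered: this is no
   restriction for a differentially closed field of characteristic 0, by
   quantifier elimination. *)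
Definition diff_saturated (T : Type) : Prop :=
  forall A : set U, (A #<= [set: T])%card ->
  forall (n : nat) (S N : set (dpoly U 'I_n)),
  (forall P, S P -> dpoly_over A P) -> (forall Q, N Q -> dpoly_over A Q) ->
  (forall s t : seq (dpoly U 'I_n),
    (forall P, P \in s -> S P) -> (forall Q, Q \in t -> N Q) ->
    exists x : 'I_n -> U, (forall P, P \in s -> deval idfun x P = 0) /\
                          (forall Q, Q \in t -> deval idfun x Q != 0)) ->
  exists x : 'I_n -> U, (forall P, S P -> deval idfun x P = 0) /\
                        (forall Q, N Q -> deval idfun x Q != 0).

Record diff_subfield (E : set U) : Prop := DiffSubfield {
  dsub1 : E 1;
  dsubB : forall x y, E x -> E y -> E (x - y);
  dsubM : forall x y, E x -> E y -> E (x * y);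
  dsubV : forall x, E x -> E x^-1;
  dsub_der : forall (i : 'I_m) x, E x -> E (der i x)
}.

Definition dadjoin k (A : set U) : set U :=
  \bigcap_(E in [set E | diff_subfield E /\ k `|` A `<=` E]) E.

Definition dindep k (I : choiceType) (x : I -> U) : Prop :=
  forall P : dpoly U I, dpoly_over k P -> deval idfun x P = 0 -> P = 0.

Definition dtrans_basis k E (r : nat) (x : 'I_r -> U) : Prop :=
  [/\ forall i, E (x i), dindep k x
    & forall y, E y -> ~ dindep k (fun o : option 'I_r => oapp x y o)].

Definition dtrdeg_is k E (r : nat) : Prop :=
  exists x : 'I_r -> U, dtrans_basis k E x.

Section AffineSpace.
Variable n : nat.
Implicit Types (V W : set 'rV[U]_n) (p : 'rV[U]_n).

Definition coords p : set U := [set p 0 i | i in [set: 'I_n]].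

Definition diff_variety k V : Prop :=
  exists S : set (dpoly U 'I_n), (forall P, S P -> dpoly_over k P) /\
    V = [set y | forall P, S P -> deval idfun (y 0) P = 0].

Definition diff_irreducible k W : Prop :=
  [/\ diff_variety k W, W !=set0 &
    forall W1 W2, diff_variety k W1 -> diff_variety k W2 ->
      W = W1 `|` W2 -> W = W1 \/ W = W2].

Definition diff_component k V W : Prop :=
  [/\ diff_irreducible k W, W `<=` V &
    forall W', diff_irreducible k W' -> W `<=` W' -> W' `<=` V -> W' = W].

Definition diff_generic k W p : Prop :=
  W p /\ forall P : dpoly U 'I_n, dpoly_over k P -> deval idfun (p 0) P = 0 ->
    forall y, W y -> deval idfun (y 0) P = 0.

(* No r satisfies diff_dim_is k set0 r. *)
Definition diff_dim_is k V (r : nat) : Prop :=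
  (exists W p, [/\ diff_component k V W, diff_generic k W p
                 & dtrdeg_is k (dadjoin k (coords p)) r]) /\
  (forall W p s, diff_component k V W -> diff_generic k W p ->
     dtrdeg_is k (dadjoin k (coords p)) s -> (s <= r)%N).

Definition hyperplane_through (a c : 'rV[U]_n) : set 'rV[U]_n :=
  [set y | \sum_(i < n) c 0 i * (y 0 i - a 0 i) = 0].

End AffineSpace.
End Universe.

(* Main.v *)
(* If p lies in V and on all the H_j but p <> a, say p_i0 <> a_i0, then every
   c_{j,i0} is a rational function over F = K<a> of p and of the c_{j,i} with
   i <> i0.  Let N(s) be the number of derivative operators of order at most s.
   In characteristic 0, once the derivative of order g of p_i is algebraic over
   the preceding derivatives (coordinate by coordinate, degree-lexicographically
   in each), so are all its further derivatives, and the shift in order is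
   bounded.  The coordinates without such a leading derivative are differentially
   independent, and they stay so at a generic point of a component of V through
   p: there are at most d of them.  Hence the derivatives of order at most s of
   p are algebraic over d N(s) + o(N(s)) elements, those of the c_{j,i} over
   ((d+1)(n-1) + d) N(s) + o(N(s)) elements, too few for (d+1)n differential
   transcendentals. *)

Require Import Defs.
From HB Require Import structures.
From mathcomp Require Import all_boot all_order all_algebra.
From mathcomp Require Import finmap.
From mathcomp.multinomials Require Import monalg.
From mathcomp.multinomials Require mpoly.
Import (coercions, canonicals) mpoly.
From mathcomp Require Import boolp classical_sets functions cardinality.
From mathcomp Require Import zify ring.

Set Implicit Arguments.
Unset Strict Implicit.
Unset Printing Implicit Defensive.

Import Order.TTheory GRing.Theory.

Local Open Scope classical_set_scope.
Local Open Scope ring_scope.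

(** * Subfields as sets, generated subfields and relative algebraic closure *)

Record subfield (U : fieldType) (E : set U) : Prop := Subfield {
  subfield1 : E 1;
  subfieldB : forall x y, E x -> E y -> E (x - y);
  subfieldM : forall x y, E x -> E y -> E (x * y);
  subfieldV : forall x, E x -> E x^-1
}.

Section SubfieldType.
Variables (U : fieldType) (E : set U) (hE : subfield E).

Definition subfield_pred of subfield E : {pred U} := fun x => `[< E x >].

Lemma subfield_predP x : reflect (E x) (x \in subfield_pred hE).
Proof. exact: asboolP. Qed.

Lemma subfield_divring_closed : divring_closed (subfield_pred hE).
Proof.
split=> [|x y|x y]; first by apply/subfield_predP; exact: subfield1.
- by move=> /subfield_predP Ex /subfield_predP Ey; apply/subfield_predP; exact: subfieldB.
- move=> /subfield_predP Ex /subfield_predP Ey; apply/subfield_predP.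
  by apply: subfieldM => //; exact: subfieldV.
Qed.

HB.instance Definition _ := GRing.isDivringClosed.Build U (subfield_pred hE)
  subfield_divring_closed.

(** Making a set-theoretic subfield into a field type gives it matrix ranks and the theory of
    integral elements. *)
Record subfield_elt : predArgType :=
  SubfieldElt {subfield_val : U; _ : subfield_val \in subfield_pred hE}.

HB.instance Definition _ := [isSub for subfield_val].
HB.instance Definition _ := [Choice of subfield_elt by <:].
HB.instance Definition _ := [SubChoice_isSubUnitRing of subfield_elt by <:].
HB.instance Definition _ := [SubNzRing_isSubComNzRing of subfield_elt by <:].
HB.instance Definition _ := [SubComUnitRing_isSubIntegralDomain of subfield_elt by <:].
HB.instance Definition _ := [SubIntegralDomain_isSubField of subfield_elt by <:].

Lemma subfield_eltP (x : subfield_elt) : E (val x).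
Proof. by apply/subfield_predP; case: x. Qed.

Lemma subfield_eltE x : E x -> {y : subfield_elt | val y = x}.
Proof. by move=> /subfield_predP Ex; exists (SubfieldElt Ex). Qed.

End SubfieldType.

Section Subfields.
Variable U : fieldType.
Implicit Types (A E G : set U).

Lemma subfield0 E : subfield E -> E 0.
Proof. by move=> hE; rewrite -(subrr 1); apply: subfieldB => //; exact: subfield1. Qed.

Lemma subfieldN E x : subfield E -> E x -> E (- x).
Proof. by move=> hE Ex; rewrite -sub0r; apply: subfieldB => //; exact: subfield0. Qed.

Lemma subfieldD E x y : subfield E -> E x -> E y -> E (x + y).
Proof.
by move=> hE Ex Ey; rewrite -[y]opprK; apply: subfieldB => //; exact: subfieldN.
Qed.

Lemma subfield_sum E (I : Type) (r : seq I) (P : pred I) (F : I -> U) :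
  subfield E -> (forall i, P i -> E (F i)) -> E (\sum_(i <- r | P i) F i).
Proof.
move=> hE EF; apply: (big_ind E) => //; first exact: subfield0.
by move=> x y; exact: subfieldD.
Qed.

Lemma subfield_prod E (I : eqType) (r : seq I) (P : pred I) (F : I -> U) :
  subfield E -> (forall i, i \in r -> P i -> E (F i)) ->
  E (\prod_(i <- r | P i) F i).
Proof.
move=> hE EF; rewrite big_seq_cond; apply: (big_ind E).
- exact: subfield1.
- by move=> x y; exact: subfieldM.
- by move=> i /andP[]; exact: EF.
Qed.

Lemma subfieldX E x n : subfield E -> E x -> E (x ^+ n).
Proof.
move=> hE Ex; elim: n => [|n IH]; first by rewrite expr0; exact: subfield1.
by rewrite exprS; exact: subfieldM.
Qed.

Definition fgen A : set U :=
  \bigcap_(E in [set E | subfield E /\ A `<=` E]) E.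

Lemma fgen_subfield A : subfield (fgen A).
Proof.
split=> [E [hE _]|x y Ax Ay E EA|x y Ax Ay E EA|x Ax E EA].
- exact: subfield1.
- by apply: subfieldB; [case: EA|exact: Ax|exact: Ay].
- by apply: subfieldM; [case: EA|exact: Ax|exact: Ay].
- by apply: subfieldV; [case: EA|exact: Ax].
Qed.
Hint Resolve fgen_subfield : core.

Lemma sub_fgen A : A `<=` fgen A.
Proof. by move=> x Ax E [_]; exact. Qed.

Lemma fgen_min A E : subfield E -> A `<=` E -> fgen A `<=` E.
Proof. by move=> hE AE x; exact. Qed.

Lemma fgen_sub A G : A `<=` fgen G -> fgen A `<=` fgen G.
Proof. exact: fgen_min. Qed.

Lemma fgenS A G : A `<=` G -> fgen A `<=` fgen G.
Proof. by move=> AG; apply: fgen_sub => x /AG; exact: sub_fgen. Qed.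

Lemma chain_subfield (E : nat -> set U) :
  (forall t, subfield (E t)) -> (forall s t, (s <= t)%N -> E s `<=` E t) ->
  subfield (\bigcup_t E t).
Proof.
move=> hE leE; split=> [|x y [s _ Ex] [t _ Ey]|x y [s _ Ex] [t _ Ey]|x [s _ Ex]].
- by exists 0%N => //; exact: subfield1.
- exists (maxn s t) => //; apply: subfieldB => //.
  + by apply: leE Ex; exact: leq_maxl.
  + by apply: leE Ey; exact: leq_maxr.
- exists (maxn s t) => //; apply: subfieldM => //.
  + by apply: leE Ex; exact: leq_maxl.
  + by apply: leE Ey; exact: leq_maxr.
- by exists s => //; exact: subfieldV.
Qed.

Definition alg E : set U :=
  [set x | exists f : {poly U}, [/\ f != 0, forall i, E f`_i & root f x]].

Lemma algS E G : E `<=` G -> alg E `<=` alg G.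
Proof. by move=> EG x [f [f0 Ef fx]]; exists f; split=> // i; exact: EG. Qed.

(** Coefficients in [E] lift along [val], and over a field algebraic and integral elements coincide.
    Closure of [alg E] under the field operations and transitivity are obtained through this. *)
Lemma alg_integral E (hE : subfield E) x :
  alg E x <-> integralOver (val : subfield_elt hE -> U) x.
Proof.
rewrite -integral_algebraic; split=> [[f [f0 Ef fx]]|[f f0 fx]].
  pose g : {poly subfield_elt hE} :=
    \poly_(i < size f) sval (subfield_eltE hE (Ef i)).
  have gE : map_poly val g = f.
    apply/polyP=> i; rewrite coef_map coef_poly.
    case: ifPn => [_|]; first by case: subfield_eltE.
    by rewrite -leqNgt => /(nth_default 0) ->.
  by exists g; rewrite ?gE //; apply: contraNneq f0 => g0; rewrite -gE g0 rmorph0.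
exists (map_poly val f); split=> //; first by rewrite map_poly_eq0.
by move=> i; rewrite coef_map; exact: subfield_eltP.
Qed.

Lemma sub_alg E : subfield E -> E `<=` alg E.
Proof.
move=> hE x Ex; have [y <-] := subfield_eltE hE Ex.
by apply/(alg_integral hE); exact: integral_id.
Qed.

Lemma alg_subfield E : subfield E -> subfield (alg E).
Proof.
move=> hE; split=> [|x y|x y|x]; first by apply: sub_alg => //; exact: subfield1.
- by rewrite !(alg_integral hE); exact: integral_sub.
- by rewrite !(alg_integral hE); exact: integral_mul.
- by rewrite !(alg_integral hE); exact: integral_inv.
Qed.

Lemma alg_trans E : subfield E -> alg (alg E) `<=` alg E.
Proof.
move=> hE x [f [f0 Ef fx]]; rewrite (alg_integral hE).
apply: (integral_root f0 fx) => y /(nthP 0)[i _ <-].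
exact/(alg_integral hE).
Qed.

(** With more rows than columns the matrix over [E] has a nonzero left kernel; a nonzero row of the
    kernel matrix gives [u]. *)
Lemma lin_dep E (R C : finType) (f : R -> C -> U) : subfield E ->
  (forall r c, E (f r c)) -> (#|C| < #|R|)%N ->
  exists u : R -> U, [/\ forall r, E (u r), exists r, u r != 0
    & forall c, \sum_r u r * f r c = 0].
Proof.
move=> hE Ef CR.
pose A : 'M[subfield_elt hE]_(#|R|, #|C|) := \matrix_(i, j)
  sval (subfield_eltE hE (Ef (enum_val i) (enum_val j))).
have : kermx A != 0.
  rewrite kermx_eq0 /row_free neq_ltn; apply/orP; left.
  exact: leq_ltn_trans (rank_leq_col A) CR.
move=> /matrix0Pn[i0 [j0 kij]].
exists (fun r => val (kermx A i0 (enum_rank r))); split.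
- by move=> r; exact: subfield_eltP.
- by exists (enum_val j0); rewrite enum_valK (fmorph_eq0 val).
- move=> c; have /matrixP/(_ i0 (enum_rank c)) := mulmx_ker A.
  rewrite !mxE => /(congr1 val); rewrite rmorph0 rmorph_sum => A0.
  rewrite -[RHS]A0 (reindex (@enum_val R predT)) /=; last exact/onW_bij/enum_val_bij.
  apply: eq_bigr => i _; rewrite enum_valK; congr (_ * _).
  by rewrite /A mxE -[RHS]/(val _) (svalP (subfield_eltE hE _)) enum_rankK.
Qed.

End Subfields.
#[export] Hint Resolve fgen_subfield : core.

(** * Algebraic dependence and independence of monomials *)

Section TranscendenceDegree.
Variables (U : fieldType) (E : set U) (hE : subfield E).
Variables (W : finType) (w : W -> U).

(** Bounding each exponent separately, rather than the total degree, makes the number of spanning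
    exponent vectors exactly [e.+1 ^ #|W|]. *)
Definition box_span (e : nat) : set U :=
  [set x | exists2 f : {ffun W -> 'I_e.+1} -> U, forall g, E (f g)
    & x = \sum_g f g * \prod_l w l ^+ g l].

Lemma box_spanD e x y : box_span e x -> box_span e y -> box_span e (x + y).
Proof.
move=> [f Ef ->] [f' Ef' ->]; exists (fun g => f g + f' g).
  by move=> g; exact: subfieldD.
by rewrite -big_split; apply: eq_bigr => g _; rewrite mulrDl.
Qed.

Lemma box_spanZ e a x : E a -> box_span e x -> box_span e (a * x).
Proof.
move=> Ea [f Ef ->]; exists (fun g => a * f g).
  by move=> g; exact: subfieldM.
by rewrite mulr_sumr; apply: eq_bigr => g _; rewrite mulrA.
Qed.

Lemma box_span_mono e (g : W -> nat) : (forall l, (g l <= e)%N) ->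
  box_span e (\prod_l w l ^+ g l).
Proof.
move=> ge; pose g0 : {ffun W -> 'I_e.+1} := [ffun l => inord (g l)].
exists (fun h => if h == g0 then 1 else 0).
  by move=> h; case: ifP => _; [exact: subfield1|exact: subfield0].
rewrite (bigD1 g0) //= eqxx mul1r [X in _ = _ + X]big1 ?addr0; last first.
  by move=> h /negbTE ->; rewrite mul0r.
by apply: eq_bigr => l _; rewrite ffunE inordK // ltnS.
Qed.

Lemma box_span0 e : box_span e 0.
Proof.
exists (fun=> 0); first by move=> _; exact: subfield0.
by rewrite big1 // => g _; rewrite mul0r.
Qed.

Lemma box_span_sum e (I : Type) (r : seq I) (P : pred I) (F : I -> U) :
  (forall i, P i -> box_span e (F i)) -> box_span e (\sum_(i <- r | P i) F i).
Proof.
move=> eF; apply: (big_ind (box_span e)) => //; first exact: box_span0.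
exact: box_spanD.
Qed.

Lemma box_spanM e e' x y :
  box_span e x -> box_span e' y -> box_span (e + e') (x * y).
Proof.
move=> [f Ef ->] [f' Ef' ->]; rewrite big_distrlr /=.
apply: box_span_sum => g _; apply: box_span_sum => g' _.
rewrite mulrACA -big_split /=; apply: box_spanZ; first exact: subfieldM.
under eq_bigr do rewrite -exprD.
apply: box_span_mono => l.
by apply: leq_add; rewrite -ltnS ltn_ord.
Qed.

Lemma box_span1 e : box_span e 1.
Proof.
have := @box_span_mono e (fun=> 0%N) (fun=> isT).
by rewrite big1 // => l _; rewrite expr0.
Qed.

Lemma box_spanC e a : E a -> box_span e a.
Proof. by move=> Ea; rewrite -[a]mulr1; exact/box_spanZ/box_span1. Qed.

Lemma box_span_prod (I : Type) (r : seq I) (P : pred I) (F : I -> U) (e : I -> nat) :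
  (forall i, P i -> box_span (e i) (F i)) ->
  box_span (\sum_(i <- r | P i) e i) (\prod_(i <- r | P i) F i).
Proof.
move=> eF; elim: r => [|i r IH]; first by rewrite !big_nil; exact: box_span1.
by rewrite !big_cons; case: ifP => // Pi; apply: box_spanM => //; exact: eF.
Qed.

Lemma box_spanX e x n : box_span e x -> box_span (n * e) (x ^+ n).
Proof.
move=> ex; elim: n => [|n IH]; first by rewrite expr0; exact: box_span1.
by rewrite exprS mulSn; exact: box_spanM.
Qed.

(** The quotients of polynomials in [w] form a subfield containing the generators; combining two of
    them adds the sizes of their boxes. *)
Lemma fgen_frac x : fgen (E `|` range w) x ->
  exists e a b, [/\ box_span e a, box_span e b, b != 0 & x = a / b].
Proof.
move: x; apply: fgen_min; last first.
  move=> x [Ex|[l _ <-]].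
    exists 0%N, x, 1; split; rewrite ?oner_eq0 ?divr1 //; [exact: box_spanC|exact: box_span1].
  exists 1%N, (w l), 1; split; rewrite ?oner_eq0 ?divr1 //; last exact: box_span1.
  have := @box_span_mono 1 (fun i => (i == l) : nat) (fun=> leq_b1 _).
  rewrite (bigD1 l) //= eqxx expr1 big1 ?mulr1 // => i /negbTE ->.
  by rewrite expr0.
split.
- by exists 0%N, 1, 1; rewrite oner_eq0 divr1; split=> //; exact: box_span1.
- move=> _ _ [e [a [b [ea eb b0 ->]]]] [e' [a' [b' [ea' eb' b0' ->]]]].
  exists (e + e')%N, (a * b' + (-1) * (b * a')), (b * b'); split.
  + apply: box_spanD; first exact: box_spanM.
    apply: box_spanZ; last exact: box_spanM.
    by apply: subfieldN => //; exact: subfield1.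
  + exact: box_spanM.
  + by rewrite mulf_neq0.
  + by field; rewrite b0 b0'.
- move=> _ _ [e [a [b [ea eb b0 ->]]]] [e' [a' [b' [ea' eb' b0' ->]]]].
  exists (e + e')%N, (a * a'), (b * b'); split; try exact: box_spanM.
  + by rewrite mulf_neq0.
  + by rewrite mulf_div.
- move=> _ [e [a [b [ea eb b0 ->]]]].
  have [->|a0] := eqVneq a 0; last by exists e, b, a; rewrite invf_div.
  by exists 0%N, 0, 1; rewrite mul0r invr0 oner_eq0 mul0r; split=> //;
     [exact: box_span0|exact: box_span1].
Qed.

(** The product of all the denominators works, and one bound [e] then serves every numerator. *)
Lemma fgen_common_denominator (I : finType) (x : I -> U) :
  (forall i, fgen (E `|` range w) (x i)) ->
  exists e b, [/\ box_span e b, b != 0 & forall i, box_span e (x i * b)].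
Proof.
move=> xf; have /choice[e /choice[a /choice[b eab]]] := fun i => fgen_frac (xf i).
have eb i : box_span (e i) (b i) by case: (eab i).
exists (\sum_i e i)%N, (\prod_i b i); split.
- exact: box_span_prod.
- by apply/prodf_neq0 => i _; case: (eab i).
- move=> i; rewrite (bigD1 i) //= [in X in _ X](bigD1 i) //=.
  have [ea _ b0 ->] := eab i; rewrite mulrA divfK //.
  by apply: box_spanM => //; exact: box_span_prod.
Qed.

Variables (T : finType) (z : T -> U).
Hypothesis z_alg : forall t, alg (fgen (E `|` range w)) (z t).

(** Multiplying the monic annihilators by powers of the indeterminate brings them to one common
    degree. *)
Lemma alg_monic_relation : exists D (x : T -> 'I_D.+1 -> U),
  forall t, (forall i, fgen (E `|` range w) (x t i)) /\
    z t ^+ D.+1 = \sum_(i < D.+1) x t i * z t ^+ i.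
Proof.
set G := fgen _.
have hG : subfield G by exact: fgen_subfield.
have : forall t, exists f : {poly U},
    [/\ f \is monic, forall i, G f`_i & root f (z t)].
  move=> t; have /(alg_integral hG)[f fmon fz] := z_alg t.
  exists (map_poly val f); split=> //; first by rewrite map_monic.
  by move=> i; rewrite coef_map; exact: subfield_eltP.
move=> /choice[f fP].
pose D := (\sum_t size (f t))%N.
pose h t := f t * 'X^(D.+2 - size (f t)).
have szf t : (size (f t) <= D.+2)%N.
  by rewrite /D (bigD1 t) //=; lia.
have hmon t : h t \is monic by rewrite monicMl ?monicXn //; case: (fP t).
have szh t : size (h t) = D.+2.
  have [fm _ _] := fP t; rewrite size_Mmonic ?monicXn ?monic_neq0 // size_polyXn.
  by have := szf t; lia.
exists D, (fun t i => - (h t)`_i) => t; have [fm Gf fz] := fP t; split.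
  move=> i; apply: (subfieldN hG); rewrite coefMXn; case: ifP => // _.
  exact: (subfield0 hG).
have : root (h t) (z t) by rewrite rootM fz.
rewrite /root horner_coef szh big_ord_recr /= => /eqP.
have -> : (h t)`_D.+1 = 1 by have /monicP := hmon t; rewrite lead_coefE szh.
rewrite mul1r addrC => /eqP; rewrite addr_eq0 => /eqP ->.
by rewrite -sumrN; apply: eq_bigr => i _; rewrite mulNr.
Qed.

(** Multiplication by [b * y] raises exponents by one. The only overflow, [y ^+ D.+1], is rewritten
    by the relation, and the factor [b] clears its denominators; so each power of [y] costs one [b]
    and widens the box by [e]. *)
Lemma box_reduce_power D (x : 'I_D.+1 -> U) (y b : U) e n :
  box_span e b -> (forall i, box_span e (x i * b)) ->
  y ^+ D.+1 = \sum_(i < D.+1) x i * y ^+ i ->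
  exists2 a : 'I_D.+1 -> U, forall i, box_span (n * e) (a i)
    & b ^+ n * y ^+ n = \sum_i a i * y ^+ i.
Proof.
move=> eb ex yD; elim: n => [|n [a ea an]].
  exists (fun i => if i == ord0 then 1 else 0).
    by move=> i; case: ifP => _; [exact: box_span1|exact: box_span0].
  rewrite !expr0 mulr1 (bigD1 ord0) //= mul1r big1 ?addr0 //.
  by move=> i /negbTE ->; rewrite mul0r.
pose a' (i : 'I_D.+1) :=
  (if unlift ord0 i is Some j then b * a (widen_ord (leqnSn D) j) else 0)
  + a ord_max * (x i * b).
exists a'.
  move=> i; rewrite mulSn; apply: box_spanD.
    by case: unliftP => [j _|_]; [exact: box_spanM|exact: box_span0].
  by rewrite addnC; exact: box_spanM.
rewrite !exprS mulrACA an mulr_sumr big_ord_recr /=.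
under [in RHS]eq_bigr do rewrite mulrDl.
rewrite big_split /=; congr (_ + _).
  rewrite big_ord_recl unlift_none mul0r add0r; apply: eq_bigr => i _.
  by rewrite liftK /= /bump /= add1n exprS; ring.
rewrite mulrACA -exprS [y ^+ _]yD mulr_sumr.
by apply: eq_bigr => i _; ring.
Qed.

(** After multiplication by a common power of [b], the [A ^ #|T|] monomials in [z] lie in an
    [E]-span whose size grows like [A ^ #|W|], so for large [A] they are linearly dependent. *)
Lemma alg_dependent : (#|W| < #|T|)%N ->
  exists A (c : {ffun T -> 'I_A} -> U), [/\ forall g, E (c g),
    exists g, c g != 0 & \sum_g c g * \prod_t z t ^+ g t = 0].
Proof.
move=> WT; have [D [x xP]] := alg_monic_relation.
have [|e [b [eb b0 ex]]] :=
  @fgen_common_denominator (T * 'I_D.+1)%type (fun ti => x ti.1 ti.2).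
  by case=> t i; case: (xP t).
pose N := #|T|; pose M := #|W|.
(* Since [Q] is linear in [A], the spanning set has at most [C * A ^ M] elements, and [A > C] makes
   this less than [A ^ M.+1 <= A ^ N]. *)
pose C := (D.+1 ^ N * (N * e).+1 ^ M)%N; pose A := C.+1.
pose Q := (N * A * e)%N.
have : forall g : {ffun T -> 'I_A}, exists f : {ffun T -> 'I_D.+1} * {ffun W -> 'I_Q.+1} -> U,
    (forall h, E (f h)) /\ b ^+ (N * A) * \prod_t z t ^+ g t
      = \sum_h f h * (\prod_t z t ^+ h.1 t * \prod_l w l ^+ h.2 l).
  move=> g.
  have : forall t, exists a : 'I_D.+1 -> U, (forall i, box_span (g t * e) (a i))
     /\ b ^+ g t * z t ^+ g t = \sum_i a i * z t ^+ i.
    move=> t; have [_ xt] := xP t.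
    have [|a ea at_] := @box_reduce_power D (x t) (z t) b e (g t) eb _ xt.
      by move=> i; exact: (ex (t, i)).
    by exists a.
  move=> /choice[a aP].
  (* The padding factor [b ^+ (N * A - \sum_t g t)] will bring every monomial to the same power of
     [b]. *)
  have gA : (\sum_t g t <= N * A)%N.
    rewrite /N -sum1_card big_distrl /=; apply: leq_sum => t _.
    by rewrite mul1n ltnW.
  have /choice[F FP] : forall h : {ffun T -> 'I_D.+1}, exists f : {ffun W -> 'I_Q.+1} -> U,
      (forall l, E (f l)) /\
      b ^+ (N * A - \sum_t g t) * \prod_t a t (h t)
        = \sum_l f l * \prod_i w i ^+ l i.
    move=> h; suff [f Ef fE] :
        box_span Q (b ^+ (N * A - \sum_t g t) * \prod_t a t (h t)) by exists f.
    rewrite /Q -[in X in box_span X](subnK gA) mulnDl.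
    apply: box_spanM; first exact: box_spanX.
    rewrite big_distrl /=; apply: box_span_prod => t _.
    by case: (aP t).
  exists (fun h => F h.1 h.2); split; first by move=> h; case: (FP h.1).
  rewrite -(subnK gA) exprD -mulrA expr_sum -big_split /=.
  under [X in _ * X = _]eq_bigr => t _ do rewrite (proj2 (aP t)).
  rewrite bigA_distr_bigA /= mulr_sumr.
  rewrite -(pair_bigA _ (fun h l => F h l * (\prod_t z t ^+ h t * \prod_i w i ^+ l i))) /=.
  apply: eq_bigr => h _; rewrite big_split /= mulrA (proj2 (FP h)) mulr_suml.
  by apply: eq_bigr => l _; rewrite mulrAC mulrA.
move=> /choice[f fP].
have [||c [Ec c0 cf]] := @lin_dep U E {ffun T -> 'I_A}
    ({ffun T -> 'I_D.+1} * {ffun W -> 'I_Q.+1})%type f hE.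
- by move=> g h; case: (fP g).
- rewrite card_prod !card_ffun !card_ord -/N -/M.
  have QA : (Q.+1 <= A * (N * e).+1)%N by rewrite /Q /A; nia.
  apply: (@leq_ltn_trans (D.+1 ^ N * (A * (N * e).+1) ^ M)).
    by rewrite leq_mul2l; case: (M) => [|M']; rewrite ?orbT // leq_exp2r ?QA ?orbT.
  rewrite expnMn mulnCA -/C.
  apply: (@leq_trans (A ^ M.+1)); last exact: leq_pexp2l.
  by rewrite expnSr ltn_pmul2l // expn_gt0.
- exists A, c; split=> //; apply/eqP.
  rewrite -(mulrI_eq0 _ (@mulfI _ (b ^+ (N * A)) _)) ?expf_neq0 // mulr_sumr.
  under eq_bigr => g _ do rewrite mulrCA (proj2 (fP g)) mulr_sumr.
  rewrite exchange_big /= big1 // => h _.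
  under eq_bigr => g _ do rewrite (mulrA (c g)).
  by rewrite -mulr_suml cf mul0r.
Qed.

End TranscendenceDegree.

(* Independence of the monomials is proved in this form, for exponent vectors
   that are distinct on [s], so that the largest variable can be peeled off. *)
Lemma transcendental_monomials_free (U : fieldType) (E : set U) (I J : eqType)
    (le : rel I) (z : I -> U) (X : seq J) (e : J -> I -> nat) (c : J -> U) (s : seq I) :
  subfield E -> transitive le ->
  (forall v, ~ alg (fgen (E `|` z @` [set w | le w v /\ w <> v])) (z v)) ->
  uniq s -> sorted (fun v w => le w v) s -> uniq X ->
  {in X &, forall j j', {in s, e j =1 e j'} -> j = j'} ->
  (forall j, E (c j)) ->
  \sum_(j <- X) c j * \prod_(v <- s) z v ^+ e j v = 0 ->
  {in X, forall j, c j = 0}.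
Proof.
move=> hE letr ztr us ss uX; elim: s us ss X uX => [_ _ X uX|v s IH /=].
  (* With no variables left, distinctness leaves room for a single index, and the sum is its
     coefficient. *)
  case: X uX => [//|j X] uX distinct Ec.
  have -> : X = [::].
    case: X uX distinct => [//|j' X] /= /andP[+ _] distinct.
    rewrite inE => /norP[+ _]; rewrite (distinct j j') ?eqxx //.
    - by rewrite mem_head.
    - by rewrite !inE eqxx orbT.
  by rewrite big_seq1 big_nil mulr1 => c0 i; rewrite inE => /eqP ->.
move=> /andP[vs us] ss X uX distinct Ec sum0.
pose D := (\sum_(j <- X) e j v)%N.
have eD j : j \in X -> (e j v < D.+1)%N.
  by move=> jX; rewrite ltnS /D (big_rem j) //= leq_addr.
pose p j : 'I_D.+1 := inord (e j v).
pose F j := c j * \prod_(w <- s) z w ^+ e j w.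
(* The head [v] of the list is the largest variable. Grouping the terms by its exponent gives a
   polynomial with root [z v] whose coefficients involve only smaller variables; it is zero because
   [z v] is transcendental over these. *)
pose f : {poly U} := \poly_(i < D.+1) \sum_(j <- X | p j == inord i) F j.
have fv : root f (z v).
  apply/eqP; rewrite horner_poly -[RHS]sum0 (partition_big p predT) //=.
  apply: eq_bigr => i _; rewrite mulr_suml inord_val.
  rewrite [LHS]big_seq_cond [RHS]big_seq_cond.
  apply: eq_bigr => j /andP[jX /eqP pj]; rewrite big_cons /F mulrCA mulrC.
  by congr (_ ^+ _ * _); rewrite -pj inordK // eD.
have s_lt w : w \in s -> le w v /\ w <> v.
  move=> ws; split; last by move=> wv; rewrite -wv ws in vs.
  have ge_trans : transitive (fun v w => le w v) by move=> a b d ab bd; exact: letr bd ab.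
  by have /allP := order_path_min ge_trans ss; exact.
have f0 : f = 0.
  apply: contra_notP (ztr v) => /eqP fN0; exists f; split=> // i.
  rewrite coef_poly; case: ifP => _; last exact: (subfield0 (fgen_subfield _)).
  apply: (subfield_sum _ (fgen_subfield _)) => j _; apply: (subfieldM (fgen_subfield _)).
    by apply: sub_fgen; left.
  apply: (subfield_prod (fgen_subfield _)) => w ws _; apply: (subfieldX _ (fgen_subfield _)).
  by apply: sub_fgen; right; exists w => //; exact: s_lt.
move=> j jX; apply: (IH us (path_sorted ss) [seq j' <- X | p j' == p j]) => //.
- exact: filter_uniq.
- move=> a b; rewrite !mem_filter => /andP[/eqP pa aX] /andP[/eqP pb bX] eab.
  apply: distinct => // w; rewrite inE => /predU1P[->|]; last exact: eab.
  have := congr1 val (etrans pa (esym pb)); rewrite /= !inordK ?eD //.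
- rewrite big_filter; have := coef_poly D.+1 (fun i => \sum_(j <- X | p j == inord i) F j) (p j).
  by rewrite -/f f0 coef0 ltn_ord inord_val => <-.
- by rewrite mem_filter eqxx.
Qed.

(** * Evaluation of differential monomials as a morphism *)

Section Monomials.
Variables (m : nat) (U : diffFieldType m) (I : choiceType) (x : I -> U).
Notation mon := (cmonom (I * {ffun 'I_m -> nat})%type).

Lemma dmonom_evalEw (d : {fset I * {ffun 'I_m -> nat}}) (k : mon) :
  (finsupp k `<=` d)%fset ->
  dmonom_eval x k = \prod_(v <- d) dern v.2 (x v.1) ^+ k v.
Proof.
move=> kd; rewrite /dmonom_eval (big_fset_incl _ kd) // => v _.
by rewrite -cmE_eq0 => /eqP ->; rewrite expr0.
Qed.

Lemma dmonom_eval_mmorphism : mmorphism (dmonom_eval x).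
Proof.
split=> [k l|]; last first.
  by rewrite (@dmonom_evalEw fset0) ?big_seq_fset0 // mdom1.
rewrite /= {1}/dmonom_eval mdomD (dmonom_evalEw (fsubsetUl _ (finsupp l))).
rewrite (dmonom_evalEw (fsubsetUr (finsupp k) _)) -big_split /=.
by apply: eq_bigr => v _; rewrite cmM exprD.
Qed.

HB.instance Definition _ :=
  isMultiplicative.Build mon U (dmonom_eval x) dmonom_eval_mmorphism.

Lemma dmonom_eval_ucm v : dmonom_eval x (ucm v) = dern v.2 (x v.1).
Proof. by rewrite /dmonom_eval mdomU big_seq_fset1 cmUU expr1. Qed.

Definition deval_rmorphism : {rmorphism dpoly U I -> U} := mmap idfun (dmonom_eval x).

Lemma devalE P : deval idfun x P = deval_rmorphism P.
Proof. by []. Qed.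

Lemma devalU a k : deval idfun x << a *g k >> = a * dmonom_eval x k.
Proof. exact: mmapU. Qed.

End Monomials.

(** * Derivations, algebraic elements and derivative operators *)

Section Derivations.
Variables (m : nat) (U : diffFieldType m).
Implicit Types (x y z : U) (E G A : set U) (g h : mpoly.multinom m).

Lemma der0 i : der i (0 : U) = 0.
Proof. by apply: (addIr (der i 0)); rewrite -derD !add0r. Qed.

Lemma derN i x : der i (- x) = - der i x.
Proof. by apply/eqP; rewrite -addr_eq0 -derD addNr der0. Qed.

Lemma der1 i : der i (1 : U) = 0.
Proof.
by apply: (addIr (der i 1)); rewrite add0r -{3}[1](mulr1 1) derM mulr1 mul1r.
Qed.

Lemma derV i x : der i x^-1 = - der i x / x ^+ 2.
Proof.
have [->|x0] := eqVneq x 0; first by rewrite invr0 der0 oppr0 mul0r.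
have := der1 i; rewrite -{1}(divff x0) derM => /eqP; rewrite addrC addr_eq0 => /eqP.
by move=> /(congr1 (fun u => x^-1 * u)); rewrite mulKf // => ->; field.
Qed.

(** Reduces a statement about derivatives of a generated field to a check on generators. *)
Lemma der_closed_subfield G i : subfield G -> subfield [set x | G x /\ G (der i x)].
Proof.
move=> hG; split=> [|x y [Gx Gx'] [Gy Gy']|x y [Gx Gx'] [Gy Gy']|x [Gx Gx']] /=.
- by rewrite der1; split; [exact: subfield1|exact: subfield0].
- by rewrite derD derN; split; exact: (subfieldB hG).
- by rewrite derM; split; [|apply: (subfieldD hG)]; exact: (subfieldM hG).
- rewrite derV; split; first exact: (subfieldV hG).
  apply: (subfieldM hG); first exact: (subfieldN hG).
  by apply/(subfieldV hG)/(subfieldX _ hG).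
Qed.

Lemma der_fgen A G i : subfield G -> A `<=` G -> der i @` A `<=` G ->
  der i @` fgen A `<=` G.
Proof.
move=> hG AG dAG _ [x Ax <-].
suff [] : [set x | G x /\ G (der i x)] x by [].
apply: fgen_min Ax; first exact: der_closed_subfield.
by move=> y Ay; split; [exact: AG|apply: dAG; exists y].
Qed.

(** The difference is the value at [z] of the polynomial with differentiated coefficients. *)
Lemma der_horner G i (f : {poly U}) z : subfield G -> G z ->
  (forall j, G f`_j) -> (forall j, G (der i f`_j)) ->
  G (der i f.[z] - f^`().[z] * der i z).
Proof.
move=> hG Gz; elim/poly_ind: f => [|f c IH] Gf Gf'.
  by rewrite deriv0 !horner0 der0 mul0r subrr; exact: subfield0.
have fS j : (f * 'X + c%:P)`_j.+1 = f`_j by rewrite coefD coefMX coefC /= addr0.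
have f0 : (f * 'X + c%:P)`_0 = c by rewrite coefD coefMX coefC /= add0r.
have {}IH : G (der i f.[z] - f^`().[z] * der i z).
  by apply: IH => j; [have := Gf j.+1|have := Gf' j.+1]; rewrite fS.
have := Gf' 0%N; rewrite f0 => Gc.
rewrite derivD derivC derivM derivX !hornerE derD derM.
rewrite (_ : _ - _ = (der i f.[z] - f^`().[z] * der i z) * z + der i c); last by ring.
by apply: (subfieldD hG) => //; exact: (subfieldM hG).
Qed.

(** For an annihilator of minimal degree, the formal derivative is nonzero in characteristic 0 and
    of smaller degree, so it cannot vanish at [z]. *)
Lemma alg_separant E z : [pchar U] =i pred0 -> alg E z -> subfield E ->
  exists f : {poly U}, [/\ forall i, E f`_i, root f z & f^`().[z] != 0].
Proof.
move=> char0 zE hE.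
have ex : exists n, `[< exists f : {poly U},
    [/\ f != 0, forall i, E f`_i, root f z & size f = n] >].
  by have [f [f0 Ef fz]] := zE; exists (size f); apply/asboolP; exists f.
case: (ex_minnP ex) => n /asboolP[f [f0 Ef fz szf]] min.
exists f; split=> //; apply/negP => f'z.
have sz1 : (1 < size f)%N by exact: root_size_gt1 fz.
have f'0 : f^`() != 0.
  apply/eqP => /polyP/(_ (size f).-2); rewrite coef_deriv coef0.
  have -> : (size f).-2.+1 = (size f).-1 by case: (size f) sz1 => [|[]].
  move/eqP; rewrite -mulr_natr mulf_eq0 -lead_coefE lead_coef_eq0 (negbTE f0) /=.
  move=> /natf0_pchar[|q]; first by case: (size f) sz1 => [|[]].
  by rewrite char0.
have : (n <= size f^`())%N.
  apply: min; apply/asboolP; exists f^`(); split=> // i.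
  rewrite coef_deriv -mulr_natr; apply: (subfieldM hE) => //.
  elim: (i.+1) => [|k IH]; first exact: subfield0.
  by rewrite -natr1; apply: (subfieldD hE) => //; exact: subfield1.
by rewrite leqNgt -szf lt_size_deriv.
Qed.

(** Differentiating [f.[z] = 0] gives a linear equation for [der i z], whose coefficient is the
    formal derivative of [f] at [z], nonzero by [alg_separant]. *)
Lemma der_alg E G i z : [pchar U] =i pred0 -> subfield E -> subfield G ->
  E `<=` G -> der i @` E `<=` G -> G z -> alg E z -> G (der i z).
Proof.
move=> char0 hE hG EG dEG Gz zE.
have [f [Ef /eqP fz f'z]] := alg_separant char0 zE hE.
have := @der_horner G i f z hG Gz (fun j => EG _ (Ef j)) (fun j => dEG _ (imageP _ (Ef j))).
rewrite fz der0 sub0r => Gd.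
rewrite (_ : der i z = - (- (f^`().[z] * der i z)) / f^`().[z]); last by field.
apply: (subfieldM hG); first exact: (subfieldN hG).
apply: (subfieldV hG); rewrite horner_coef; apply: (subfield_sum _ hG) => j _.
apply: (subfieldM hG); last exact: (subfieldX _ hG).
rewrite coef_deriv -mulr_natr; apply: (subfieldM hG); first exact/EG.
elim: (j.+1) => [|k IH]; first exact: subfield0.
by rewrite -natr1; apply: (subfieldD hG) => //; exact: subfield1.
Qed.

Lemma iter_der_comm i j n x : der i (iter n (der j) x) = iter n (der j) (der i x).
Proof. by elim: n => //= n IH; rewrite der_comm IH. Qed.

(** Operators are indexed here by multinomials, which carry the addition, the degree and the
    monomial order. *)
Definition dm g x : U := dern [ffun i => g i] x.

Lemma dm0 x : dm mpoly.mnm0 x = x.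
Proof.
by rewrite /dm /dern; elim: (enum _) => //= i s ->; rewrite ffunE mpoly.mnm0E.
Qed.

Lemma dmS i g x : dm (mpoly.mnm_add g (mpoly.mnm1 i)) x = der i (dm g x).
Proof.
rewrite /dm /dern.
have : i \in enum 'I_m by rewrite mem_enum.
have := enum_uniq 'I_m; elim: (enum _) => //= j s IH /andP[js us].
rewrite inE !ffunE mpoly.mnmDE mpoly.mnm1E; have [ij|ji] := eqVneq i j.
  subst j => _; rewrite addn1 iterS; congr (der _ (iter _ _ _)).
  (* [j] does not occur in the rest of the list, so raising its exponent changes nothing there. *)
  elim: s js {IH us} => //= l s IH; rewrite inE => /norP[il ils].
  by rewrite !ffunE mpoly.mnmDE mpoly.mnm1E (negbTE il) addn0 IH.
by move=> /= /(IH us) ->; rewrite addn0 iter_der_comm.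
Qed.

End Derivations.

Notation exponent := mpoly.multinom.
Notation madd := mpoly.mnm_add.
Notation munit := mpoly.mnm1.
Notation mdegree := mpoly.mdeg.
Notation mdvd := mpoly.lem.

Lemma exponent_ind m (P : exponent m -> Prop) :
  P mpoly.mnm0 -> (forall g i, P g -> P (madd g (munit i))) -> forall g, P g.
Proof.
move=> P0 PS g; move: {2}(mdegree g) (erefl (mdegree g)) => N.
elim: N g => [|N IH] g.
  by move=> /eqP; rewrite mpoly.mdeg_eq0 => /eqP ->.
move=> gN; have [i gi] : exists i, g i != 0%N.
  apply/existsP; rewrite -negb_forall; apply/negP => /forallP g0.
  suff g0E : g = mpoly.mnm0 by rewrite g0E mpoly.mdeg0 in gN.
  by apply/mpoly.mnmP => i; rewrite mpoly.mnm0E; exact/eqP.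
have gE : madd (mpoly.mnm_sub g (munit i)) (munit i) = g.
  by rewrite mpoly.submK // mpoly.lep1mP.
rewrite -gE; apply/PS/IH.
by move: gN; rewrite -{1}gE mpoly.mdegD mpoly.mdeg1 addn1 => -[].
Qed.

Definition mnm_of m (e : {ffun 'I_m -> nat}) : exponent m :=
  mpoly.Multinom [tuple e i | i < m].

Lemma mnm_ofK m (e : {ffun 'I_m -> nat}) : [ffun i => mnm_of e i] = e.
Proof. by apply/ffunP => i; rewrite ffunE mpoly.multinomE tnth_mktuple. Qed.

Lemma mnm_of_inj m : injective (@mnm_of m).
Proof. by move=> e f ef; rewrite -(mnm_ofK e) ef mnm_ofK. Qed.

Lemma dm_mnm_of m (U : diffFieldType m) e (x : U) : dm (mnm_of e) x = dern e x.
Proof. by rewrite /dm mnm_ofK. Qed.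

(** * Leading derivatives for an elimination ranking *)

Section LeadingDerivatives.
Variables (m n : nat) (U : diffFieldType m) (p : 'I_n -> U) (k : set U).
Hypotheses (char0 : [pchar U] =i pred0) (hk : subfield k).
Hypothesis k_der : forall i x, k x -> k (der i x).
Implicit Types (i : 'I_n) (g h : exponent m) (t : nat).

(** All derivatives of an earlier coordinate come before any of a later one. Rank therefore does not
    bound order, and the order bound [t] is carried separately below. *)
Definition precedes i' h i g : Prop := (i' < i)%N \/ i' = i /\ (h < g)%O.

Definition lower_derivatives i g (t : nat) : set U :=
  [set x | exists i' h, [/\ precedes i' h i g, (mdegree h <= t)%N & x = dm h (p i')]].

Definition lower i g t : set U := fgen (k `|` lower_derivatives i g t).

Definition leading i g : Prop := alg (\bigcup_t lower i g t) (dm g (p i)).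

Lemma lower_le i g s t : (s <= t)%N -> lower i g s `<=` lower i g t.
Proof.
move=> st; apply: fgenS => x [kx|[i' [h [pr hs ->]]]]; [by left|right].
by exists i', h; split=> //; exact: leq_trans st.
Qed.

(** An annihilating polynomial has finitely many coefficients, so one order bound covers them
    all. *)
Lemma alg_lower_bounded i g x : alg (\bigcup_t lower i g t) x ->
  exists t, alg (lower i g t) x.
Proof.
move=> [f [f0 Ef fx]].
have /choice[t tP] : forall j, exists t, lower i g t f`_j.
  by move=> j; have [t _ ft] := Ef j; exists t.
exists (\sum_(j < size f) t j)%N, f; split=> // j.
have [jf|jf] := ltnP j (size f); last first.
  by rewrite nth_default //; exact: (subfield0 (fgen_subfield _)).
apply: lower_le (tP j).
by rewrite (bigD1 (Ordinal jf)) //= leq_addr.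
Qed.

Lemma precedes_addr i' h i g j : precedes i' h i g -> precedes i' h i (madd g (munit j)).
Proof.
move=> [?|[-> hg]]; [by left|right; split=> //].
exact: lt_le_trans hg (mpoly.lemc_addr _ _).
Qed.

Lemma precedes_add i' h i g j :
  precedes i' h i g -> precedes i' (madd h (munit j)) i (madd g (munit j)).
Proof. by move=> [?|[-> hg]]; [left|right; rewrite mpoly.ltmc_add2l]. Qed.

(** By [der_alg], the next derivative is even rational over the derivatives that precede it. The
    bound on [mdegree g] ensures that [dm g (p i)] itself counts among the generators of order at
    most [t.+1]. *)
Lemma alg_lower_step i g t j : (mdegree g <= t)%N ->
  alg (lower i g t) (dm g (p i)) ->
  alg (lower i (madd g (munit j)) t.+1) (dm (madd g (munit j)) (p i)).
Proof.
move=> gt alg_g; set g' := madd g _.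
have hL s h : subfield (lower i h s) by exact: fgen_subfield.
have gens : k `|` lower_derivatives i g t `<=` lower i g' t.+1.
  move=> x [kx|[i' [h [pr ht ->]]]]; apply: sub_fgen; [by left|right].
  by exists i', h; split; [exact: precedes_addr|exact: leqW|].
apply: (sub_alg (hL _ _)); rewrite /g' dmS.
apply: (der_alg char0 (hL t g) (hL _ _) _ _ _ alg_g).
- exact: fgen_min.
- apply: der_fgen => // _ [x [kx|[i' [h [pr ht ->]]]] <-]; apply: sub_fgen.
    by left; exact: k_der.
  right; exists i', (madd h (munit j)); split; first exact: precedes_add.
    by rewrite mpoly.mdegD mpoly.mdeg1 addn1.
  by rewrite dmS.
- apply: sub_fgen; right; exists i, g; split=> //; last exact: leqW.
  by right; split=> //; apply: mpoly.lt_mdeg_ltmc; rewrite mpoly.mdegD mpoly.mdeg1 addn1.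
Qed.

Lemma alg_lower_shift i g t h : (mdegree g <= t)%N ->
  alg (lower i g t) (dm g (p i)) ->
  alg (lower i (madd g h) (t + mdegree h)) (dm (madd g h) (p i)).
Proof.
move=> gt alg_g; elim/exponent_ind: h => [|h j IH].
  by rewrite mpoly.addm0 mpoly.mdeg0 addn0.
rewrite mpoly.addmA mpoly.mdegD mpoly.mdeg1 addnA addn1.
by apply: alg_lower_step IH; rewrite mpoly.mdegD leq_add2r.
Qed.

Section Cover.
Variables (lead : 'I_n -> option (exponent m)) (T : nat).
Hypothesis leadP : forall i g, lead i = Some g ->
  (mdegree g <= T)%N /\ alg (lower i g T) (dm g (p i)).

(** [mdvd g0 g] is the componentwise order: it says that [dm g] is a further derivative of
    [dm g0]. *)
Definition kept i g : bool := if lead i is Some g0 then ~~ mdvd g0 g else true.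

(** Induction on the coordinate, then on the monomial order. A derivative that is not kept is
    algebraic over preceding ones; within its coordinate the order does not grow, while passing to
    an earlier coordinate may raise it by [T]. The budget [S + (n - i) * T] pays for this, as
    [n - i] grows when [i] falls. *)
Lemma kept_cover S i g : (mdegree g <= S + (n - i) * T)%N ->
  alg (fgen (k `|` [set x | exists i g,
    [/\ kept i g, (mdegree g <= S + n * T)%N & x = dm g (p i)]])) (dm g (p i)).
Proof.
set K := fgen _; have hK : subfield K by exact: fgen_subfield.
move: {2}(i : nat) (leqnn i) => N; elim/ltn_ind: N i g => N IHN i g iN.
elim/(@mpoly.ltmwf m): g => g IHg gS.
have [kg|] := boolP (kept i g).
  apply: (sub_alg hK); apply: sub_fgen; right; exists i, g; split=> //.
  by apply: leq_trans gS _; rewrite leq_add2l leq_mul2r leq_subr orbT.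
rewrite /kept; case lead_i: (lead i) => [g0|//]; rewrite negbK => g0g.
have [g0T alg_g0] := leadP lead_i.
have gE : madd g0 (mpoly.mnm_sub g g0) = g by rewrite mpoly.addmC mpoly.submK.
have := alg_lower_shift (mpoly.mnm_sub g g0) g0T alg_g0; rewrite gE => alg_g.
apply: (alg_trans hK); apply: algS alg_g; apply: fgen_min.
  exact: alg_subfield.
move=> x [kx|[i' [h [pr ht ->]]]].
  by apply: (sub_alg hK); apply: sub_fgen; left.
case: pr => [i'i|[-> hg]]; last first.
  apply: IHg => //; apply: leq_trans gS; apply: mpoly.lemc_mdeg; exact: ltW.
apply: (IHN i') => //; first exact: leq_trans iN.
apply: (leq_trans ht); have := congr1 (@mdegree m) gE; rewrite mpoly.mdegD => gD.
have /leq_trans : (T + mdegree (mpoly.mnm_sub g g0) <= mdegree g + T)%N by lia.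
apply; apply: leq_trans (_ : S + (n - i) * T + T <= _)%N; first by rewrite leq_add2r.
rewrite -addnA -mulSnr leq_add2l leq_mul2r; apply/orP; right.
by have := ltn_ord i; lia.
Qed.

End Cover.

(** Every derivative of such a coordinate is transcendental over all preceding derivatives, so
    distinct monomials in them are linearly independent over [k]. *)
Lemma non_leading_dindep r (sigma : 'I_r -> 'I_n) : injective sigma ->
  (forall l g, ~ leading (sigma l) g) -> dindep k (p \o sigma).
Proof.
move=> sigma_inj nlead P Pk P0.
pose z (v : 'I_r * {ffun 'I_m -> nat}) := dern v.2 (p (sigma v.1)).
pose le (v w : 'I_r * {ffun 'I_m -> nat}) := (sigma v.1 < sigma w.1)%N
  || (v.1 == w.1) && (mnm_of v.2 <= mnm_of w.2)%O.
pose d := (\bigcup_(u <- msupp P) finsupp u)%fset.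
pose s := sort (fun v w => le w v) d.
have le_trans : transitive le.
  move=> [b f] [a e] [c g]; rewrite /le /=.
  move=> /orP[ab|/andP[/eqP -> ef]] /orP[bc|/andP[/eqP <- fg]].
  - by rewrite (ltn_trans ab bc).
  - by rewrite ab.
  - by rewrite bc.
  - by rewrite eqxx (le_trans ef fg) orbT.
have le_total : total (fun v w => le w v).
  move=> [a e] [b f]; rewrite /le /=; case: (ltngtP (sigma a) (sigma b)) => ab /=; rewrite ?orbT //.
  have -> : a = b by apply/sigma_inj/val_inj; rewrite /= ab.
  by rewrite eqxx /= le_total.
apply/malgP => u; rewrite mcoeff0.
have [uP|] := boolP (u \in msupp P); last exact: mcoeff_outdom.
have := @transcendental_monomials_free U k _ _ le z (msupp P)
  (fun u v => u v) (fun u => P@_u) s hk le_trans.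
apply=> //.
- move=> v alg_v; apply: (nlead v.1 (mnm_of v.2)); rewrite /leading dm_mnm_of.
  move: alg_v; apply: algS; apply: fgen_min.
    apply: chain_subfield => [t|]; first exact: fgen_subfield.
    by move=> ? ?; exact: lower_le.
  move=> x [kx|[w [wv /eqP w_v] <-]]; first by exists 0%N => //; apply: sub_fgen; left.
  exists (mdegree (mnm_of w.2)) => //; apply: sub_fgen; right.
  exists (sigma w.1), (mnm_of w.2); split; rewrite ?dm_mnm_of //.
  case/orP: wv => [|/andP[/eqP wv1 wv2]]; [by left|right].
  rewrite wv1 lt_neqAle wv2 andbT; split=> //; apply: contra w_v => /eqP/mnm_of_inj wv2E.
  by rewrite [w]surjective_pairing wv1 wv2E -surjective_pairing.
- by rewrite sort_uniq fset_uniq.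
- exact: sort_sorted.
(* Exponents are compared only on the variables occurring in [P]; elsewhere they vanish. *)
- move=> a b aP bP ab; apply/eqP/cmP => v.
  have [vd|vd] := boolP (v \in d); first by apply: ab; rewrite mem_sort.
  have no c : c \in msupp P -> c v = 0%N.
    move=> cP; apply/eqP; rewrite cmE_eq0; apply: contra vd => vc.
    by apply/bigfcupP; exists c; rewrite // cP.
  by rewrite !no.
- rewrite -[RHS]P0 /deval mmapE big_seq [RHS]big_seq; apply: eq_bigr => c cP.
  congr (_ * _); rewrite (@dmonom_evalEw _ _ _ _ d); last first.
    by apply: bigfcup_sup.
  by apply: perm_big; rewrite perm_sort.
Qed.

End LeadingDerivatives.

(** * The number of derivative operators of order at most [s] and its growth *)

Definition count_exponents (m s : nat) : nat := #|{: mpoly.bmultinom m s.+1}|.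

Section Growth.
Variable m : nat.
Notation N := (count_exponents m).

Lemma count_exponents_gt0 s : (0 < N s)%N.
Proof. by apply/card_gt0P; exists mpoly.bm0. Qed.

Lemma mnm_le_mdeg (g : exponent m) i : (g i <= mdegree g)%N.
Proof. by rewrite mpoly.mdegE (bigD1 i) //= leq_addr. Qed.

Lemma count_exponents_le s : (N s <= s.+1 ^ m)%N.
Proof.
rewrite -[X in (_ <= X ^ _)%N]card_ord -[X in (_ <= _ ^ X)%N]card_ord -card_ffun.
apply: (@leq_card _ _ (fun b : mpoly.bmultinom m s.+1 =>
  [ffun i => inord (b i)] : {ffun 'I_m -> 'I_s.+1})).
have lts (b : mpoly.bmultinom m s.+1) i : (b i < s.+1)%N.
  exact: leq_ltn_trans (mnm_le_mdeg b i) (mpoly.bmdeg b).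
move=> b c /ffunP bc; apply/val_inj/mpoly.mnmP => i.
by have := congr1 val (bc i); rewrite !ffunE /= !inordK.
Qed.

(** The ratio of [N (s + B)] to [N s] comes arbitrarily close to 1: otherwise [N (j * B)] would grow
    geometrically in [j], with ratio [q.+1 / q], against the polynomial bound. *)
Lemma count_exponents_growth q B : exists s, (q * N (s + B) < q.+1 * N s)%N.
Proof.
apply: contrapT => /forallNP no.
have {}no s : (q.+1 * N s <= q * N (s + B))%N by rewrite leqNgt; apply/negP.
have q0 : (0 < q)%N.
  by case: q no => // /(_ 0%N); rewrite mul1n leqNgt count_exponents_gt0.
have iter j : (q.+1 ^ j <= q ^ j * N (j * B))%N.
  elim: j => [|j IH]; first by rewrite !expn0 mul1n count_exponents_gt0.
  rewrite !expnS; apply: (leq_trans (n := q.+1 * (q ^ j * N (j * B)))).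
    by rewrite leq_mul2l.
  by rewrite mulnCA (mulnC q) -mulnA leq_mul2l (mulSn j) (addnC B) no orbT.
(* Bernoulli's inequality [(1 + 1/q)^j >= 1 + j/q], cleared of denominators; at [j = q] it yields
   the factor 2. *)
have bern j : (q ^ j * (q + j) <= q * q.+1 ^ j)%N.
  elim: j => [|j IH]; first by rewrite !expn0 addn0 mul1n muln1.
  rewrite !expnS; move: (q ^ j)%N (q.+1 ^ j)%N IH => a b /(leq_mul (leqnn q.+1)).
  by nia.
have two : (2 * q ^ q <= q.+1 ^ q)%N.
  by have := bern q; move: (q ^ q)%N (q.+1 ^ q)%N => a b; nia.
have pow l : (2 ^ l <= (q * l * B).+1 ^ m)%N.
  have : (2 ^ l * q ^ (q * l) <= (q * l * B).+1 ^ m * q ^ (q * l))%N.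
    apply: leq_trans (_ : q.+1 ^ (q * l) <= _)%N.
      by rewrite !expnM -expnMn; case: l => // l; rewrite leq_exp2r.
    apply: leq_trans (iter _) _; rewrite mulnC leq_mul2r.
    by rewrite count_exponents_le orbT.
  by rewrite leq_pmul2r // expn_gt0 q0.
(* For the exponent [m.+1 * u], the left side of [pow] is [(2 ^ u) ^ m.+1]. The right side is at
   most [(C * 2 ^ u) ^ m = u * (2 ^ u) ^ m], which is smaller because [u < 2 ^ u]. *)
pose C := (q * m.+1 * B).+1; pose u := (C ^ m)%N.
have := pow (m.+1 * u)%N; rewrite leqNgt => /negP; apply.
have ult : (u < 2 ^ u)%N by exact: ltn_expl.
have le1 : ((q * (m.+1 * u) * B).+1 <= C * 2 ^ u)%N.
  apply: leq_trans (_ : C * u.+1 <= _)%N; last by rewrite leq_mul2l ult orbT.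
  by rewrite /C; nia.
apply: (@leq_ltn_trans ((C * 2 ^ u) ^ m)).
  by case: (m) le1 => // m' le1; rewrite leq_exp2r.
rewrite expnMn -/u mulnC (mulnC m.+1) [(2 ^ (u * _))%N]expnM expnS.
by rewrite mulnC ltn_pmul2r // !expn_gt0.
Qed.

(** Adding [g0] embeds the exponents of degree at most [S] into the multiples of [g0] of degree at
    most [B]. *)
Lemma count_not_multiples (g0 : exponent m) S T B : (mdegree g0 <= T)%N ->
  (S + T <= B)%N ->
  (#|[pred b : mpoly.bmultinom m B.+1 | ~~ mdvd g0 b]| + N S <= N B)%N.
Proof.
move=> g0T STB.
rewrite {2}/count_exponents -(cardC [pred b : mpoly.bmultinom m B.+1 | ~~ mdvd g0 b]).
rewrite leq_add2l.
have lt_b (b : mpoly.bmultinom m S.+1) : (mdegree (madd g0 b) < B.+1)%N.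
  by rewrite mpoly.mdegD; have := mpoly.bmdeg b; lia.
pose f b : mpoly.bmultinom m B.+1 := mpoly.BMultinom (lt_b b).
have f_inj : injective f.
  by move=> b c /(congr1 val) /= /mpoly.addmI bc; exact: val_inj.
rewrite /count_exponents -(card_codom f_inj); apply/subset_leq_card/fintype.subsetP => c.
by move=> /codomP[b ->]; rewrite !inE negbK /= mpoly.lem_addr.
Qed.

End Growth.

(** * Differential independence and the bound it gives on generators *)

Section MonomialsOfFamilies.
Variables (I : choiceType) (T : choiceType) (v : T -> I) (e : T -> nat).
Hypothesis v_inj : injective v.

(** Exponents prescribed on an index type are transported along [v] to the variables of a
    monomial. *)
Definition cm_of (r : seq T) : cmonom I :=
  \big[mmul/mone]_(t <- r) \big[mmul/mone]_(l < e t) ucm (v t).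

Lemma cm_ofE r t : uniq r -> cm_of r (v t) = if t \in r then e t else 0%N.
Proof.
have cmX n i j : (\big[mmul/mone]_(l < n) ucm i : cmonom I) j = (n * (i == j))%N.
  by elim: n => [|n IH]; rewrite ?big_ord0 ?cm1 // big_ord_recl cmM IH cmU mulSn.
rewrite /cm_of; elim: r => [|s r IH] /=; first by rewrite big_nil cm1.
move=> /andP[sr /IH {}IH]; rewrite big_cons cmM IH cmX (inj_eq v_inj) inE.
have [->|ts] := eqVneq t s; first by rewrite (negbTE sr) muln1 addn0.
by rewrite muln0.
Qed.

End MonomialsOfFamilies.

Lemma dmonom_eval_cm_of m (U : diffFieldType m) (I T : choiceType) (x : I -> U)
    (v : T -> I * {ffun 'I_m -> nat}) e r :
  dmonom_eval x (cm_of v e r) = \prod_(t <- r) dern (v t).2 (x (v t).1) ^+ e t.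
Proof.
rewrite (big_morph (dmonom_eval x) (@mmorphM _ _ _) (@mmorph1 _ _ _)).
apply: eq_bigr => t _.
rewrite (big_morph (dmonom_eval x) (@mmorphM _ _ _) (@mmorph1 _ _ _)).
by rewrite dmonom_eval_ucm prodr_const card_ord.
Qed.

Lemma mcoeff_sumU (K : choiceType) (G : zmodType) (T : eqType) (r : seq T)
    (mon : T -> K) (c : T -> G) t : injective mon -> uniq r -> t \in r ->
  (\sum_(s <- r) << c s *g mon s >>)@_(mon t) = c t.
Proof.
move=> mon_inj ur tr; rewrite raddf_sum (big_rem t) //= mcoeffUU.
rewrite big_seq big1 ?addr0 // => s; rewrite mem_rem_uniq // inE => /andP[st _].
by rewrite mcoeffU (inj_eq mon_inj) (negbTE st).
Qed.

Lemma mcoeff_sumU_subfield (K : choiceType) (U : fieldType) (k : set U) (T : Type)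
    (r : seq T) (mon : T -> K) (c : T -> U) u : subfield k -> (forall t, k (c t)) ->
  k (\sum_(s <- r) << c s *g mon s >>)@_u.
Proof.
move=> hk kc; rewrite raddf_sum; apply: (subfield_sum _ hk) => t _ /=.
by rewrite mcoeffU; case: eqP => _; rewrite ?mulr1n ?mulr0n //; exact: subfield0.
Qed.

Lemma deval_sumU (m : nat) (U : diffFieldType m) (I : choiceType) (x : I -> U)
    (T : Type) (r : seq T) (mon : T -> cmonom (I * {ffun 'I_m -> nat})%type)
    (c : T -> U) :
  deval idfun x (\sum_(s <- r) << c s *g mon s >>)
    = \sum_(s <- r) c s * dmonom_eval x (mon s).
Proof.
rewrite devalE (raddf_sum (deval_rmorphism x)).
by apply: eq_bigr => s _; exact: devalU.
Qed.

Section DifferentialIndependence.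
Variables (m : nat) (U : diffFieldType m) (k : set U).
Hypothesis hk : subfield k.

(** The relation is the value at [x] of a differential polynomial whose monomials are pairwise
    distinct, [v] being injective, so the [c a] are its coefficients. *)
Lemma dindep_free (I T : finType) (A : nat) (x : I -> U) (v : T -> I * exponent m)
    (c : {ffun T -> 'I_A} -> U) :
  injective v -> dindep k x -> (forall a, k (c a)) ->
  \sum_a c a * \prod_t dm (v t).2 (x (v t).1) ^+ a t = 0 -> forall a, c a = 0.
Proof.
move=> v_inj x_indep kc rel0 a.
pose v' t := ((v t).1, [ffun i => (v t).2 i] : {ffun 'I_m -> nat}).
have v'_inj : injective v'.
  move=> s t [st1 /ffunP st2]; apply: v_inj.
  rewrite [v s]surjective_pairing [v t]surjective_pairing st1; congr (_, _).
  by apply/mpoly.mnmP => i; have := st2 i; rewrite !ffunE.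
pose mon (a : {ffun T -> 'I_A}) := cm_of v' (fun t => a t : nat) (index_enum T).
have mon_inj : injective mon.
  move=> b b' bb; apply/ffunP => t; apply: val_inj.
  have := congr1 (fun u : cmonom _ => u (v' t)) bb.
  by rewrite /mon !(cm_ofE _ v'_inj) ?index_enum_uniq // mem_index_enum.
pose P : dpoly U I := \sum_b << c b *g mon b >>.
have Pmon b : P@_(mon b) = c b.
  by apply: mcoeff_sumU => //; [exact: index_enum_uniq|exact: mem_index_enum].
rewrite -Pmon (x_indep P) ?mcoeff0 //.
- by move=> u; exact: mcoeff_sumU_subfield.
- rewrite deval_sumU -[RHS]rel0; apply: eq_bigr => b _.
  by rewrite dmonom_eval_cm_of.
Qed.

(** The derivatives of [x] of order at most [S] are algebraically independent, so they cannot all be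
    algebraic over fewer generators. *)
Lemma dindep_bound (I W : finType) (x : I -> U) (w : W -> U) S :
  dindep k x ->
  (forall i g, (mdegree g <= S)%N -> alg (fgen (k `|` range w)) (dm g (x i))) ->
  (#|I| * count_exponents m S <= #|W|)%N.
Proof.
move=> x_indep x_alg; rewrite leqNgt; apply/negP => small.
pose T := (I * mpoly.bmultinom m S.+1)%type.
pose v (t : T) : I * exponent m := (t.1, t.2 : exponent m).
have v_inj : injective v by move=> [a b] [c d] [-> /val_inj ->].
have [||A [c [kc [a ca] c0]]] := @alg_dependent U k hk W w T
    (fun t => dm (v t).2 (x (v t).1)).
- by move=> [i g]; apply: x_alg; have := mpoly.bmdeg g.
- by rewrite card_prod.
- by move/eqP: ca; apply; exact: dindep_free c0 a.
Qed.

(** Renaming variables along an injection keeps distinct monomials distinct, so no coefficients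
    merge. *)
Lemma dpoly_rename (I J : choiceType) (sigma : I -> J) (P : dpoly U I) :
  injective sigma -> dpoly_over k P -> exists Q : dpoly U J,
    [/\ dpoly_over k Q, forall y : J -> U, deval idfun y Q = deval idfun (y \o sigma) P
      & Q = 0 -> P = 0].
Proof.
move=> sigma_inj Pk.
pose v (t : I * {ffun 'I_m -> nat}) := (sigma t.1, t.2).
have v_inj : injective v by move=> [i e] [j f] [/sigma_inj -> ->].
pose mon (u : cmonom (I * {ffun 'I_m -> nat})%type) := cm_of v u (finsupp u).
have mon_inj : injective mon.
  have monE u t : mon u (v t) = u t.
    by rewrite /mon cm_ofE //; case: finsuppP.
  by move=> u u' uu; apply/eqP/cmP => t; rewrite -!monE uu.
pose Q : dpoly U J := \sum_(u <- msupp P) << P@_u *g mon u >>.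
exists Q; split.
- by move=> u; exact: mcoeff_sumU_subfield.
- move=> y; rewrite deval_sumU [RHS]mmapE; apply: eq_bigr => u _.
  by rewrite dmonom_eval_cm_of.
- move=> Q0; apply/malgP => u; rewrite mcoeff0.
  have [uP|] := boolP (u \in msupp P); last exact: mcoeff_outdom.
  have <- : Q@_(mon u) = P@_u by apply: mcoeff_sumU => //; exact: fset_uniq.
  by rewrite Q0 mcoeff0.
Qed.

Lemma dindep_comp (I J : choiceType) (sigma : I -> J) (x : J -> U) :
  injective sigma -> dindep k x -> dindep k (x \o sigma).
Proof.
move=> sigma_inj x_indep P Pk; have [Q [Qk QE Q0]] := dpoly_rename sigma_inj Pk.
by rewrite -QE => /(x_indep _ Qk).
Qed.

End DifferentialIndependence.

(** * Differentially generated fields and differential transcendence bases *)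

Section DifferentialClosure.
Variables (m : nat) (U : diffFieldType m).
Implicit Types (k A E : set U) (g h : exponent m).

Lemma diff_subfield_subfield E : diff_subfield E -> subfield E.
Proof. by move=> hE; split; [apply: dsub1|apply: dsubB|apply: dsubM|apply: dsubV]. Qed.

Lemma dadjoin_diff_subfield k A : diff_subfield (dadjoin k A).
Proof.
split=> [E [hE _]|x y Ax Ay E kE|x y Ax Ay E kE|x Ax E kE|i x Ax E kE].
- exact: dsub1.
- by apply: dsubB; [case: kE|exact: Ax|exact: Ay].
- by apply: dsubM; [case: kE|exact: Ax|exact: Ay].
- by apply: dsubV; [case: kE|exact: Ax].
- by apply: dsub_der; [case: kE|exact: Ax].
Qed.

Lemma sub_dadjoin k A : k `|` A `<=` dadjoin k A.
Proof. by move=> x Ax E [_]; exact. Qed.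

(** A filtration by order of the differential field generated by [y] over [k]. *)
Definition dgen k (L : Type) (y : L -> U) (t : nat) : set U :=
  fgen (k `|` [set x | exists l h, (mdegree h <= t)%N /\ x = dm h (y l)]).

Lemma dgen_le k (L : Type) (y : L -> U) s t :
  (s <= t)%N -> dgen k y s `<=` dgen k y t.
Proof.
move=> st; apply: fgenS => x [kx|[l [h [hs ->]]]]; [by left|right].
by exists l, h; split=> //; exact: leq_trans st.
Qed.

Lemma der_dgen k (L : Type) (y : L -> U) t i x : diff_subfield k ->
  dgen k y t x -> dgen k y t.+1 (der i x).
Proof.
move=> hk xt; suff : der i @` dgen k y t `<=` dgen k y t.+1 by apply; exists x.
apply: der_fgen; first exact: fgen_subfield.
  by move=> u ut; apply: (@dgen_le k L y t _ (leqnSn t)); exact: sub_fgen.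
move=> _ [u [ku|[l [h [ht ->]]]] <-]; apply: sub_fgen; first by left; exact: dsub_der.
right; exists l, (madd h (munit i)); rewrite dmS; split=> //.
by rewrite mpoly.mdegD mpoly.mdeg1 addn1.
Qed.

Lemma dm_dgen k (L : Type) (y : L -> U) t g x : diff_subfield k ->
  dgen k y t x -> dgen k y (t + mdegree g) (dm g x).
Proof.
move=> hk xt; elim/exponent_ind: g => [|g i IH].
  by rewrite dm0 mpoly.mdeg0 addn0.
by rewrite dmS mpoly.mdegD mpoly.mdeg1 addn1 addnS; exact: der_dgen.
Qed.

Section TranscendenceBases.
Variables (n : nat) (k : set U) (hk : diff_subfield k) (p : 'rV[U]_n).

Lemma dadjoin_dgen : dadjoin k (coords p) `<=` \bigcup_t dgen k (p 0) t.
Proof.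
apply: bigcap_inf; split.
  have [h1 hB hM hV] : subfield (\bigcup_t dgen k (p 0) t).
    apply: chain_subfield => [t|s t]; [exact: fgen_subfield|exact: dgen_le].
  by split=> // i x [t _ xt]; exists t.+1 => //; exact: der_dgen.
move=> x [kx|[i _ <-]]; exists 0%N => //; apply: sub_fgen; [by left|right].
by exists i, mpoly.mnm0; rewrite mpoly.mdeg0 dm0.
Qed.

(** If the [x i] have order at most [T] in [p], their derivatives of order at most [S] have order at
    most [S + T]. Writing [N] for the count of operators, [r * N S <= n * N (S + T) < n.+1 * N S]
    for a suitable [S]. *)
Lemma dindep_coords_le r (x : 'I_r -> U) :
  (forall i, dadjoin k (coords p) (x i)) -> dindep k x -> (r <= n)%N.
Proof.
move=> xE x_indep; have /choice[t xt] : forall i, exists t, dgen k (p 0) t (x i).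
  by move=> i; have [t _ xt] := dadjoin_dgen (xE i); exists t.
pose T := (\sum_i t i)%N.
have {}xt i : dgen k (p 0) T (x i).
  by apply: dgen_le (xt i); rewrite /T (bigD1 i) //= leq_addr.
have [S growth] := count_exponents_growth m n T.
rewrite leqNgt; apply/negP => rn.
pose w (v : 'I_n * mpoly.bmultinom m (S + T).+1) := dm v.2 (p 0 v.1).
have hk' := diff_subfield_subfield hk.
have := @dindep_bound m U k hk' _ _ x w S x_indep.
rewrite card_prod !card_ord -/(count_exponents m (S + T)) => bound.
have : (r * count_exponents m S <= n * count_exponents m (S + T))%N.
  apply: bound => i g gS; apply: (sub_alg (fgen_subfield _)).
  have := @dm_dgen k _ _ _ g _ hk (xt i); apply: fgenS => u [ku|[l [h [hT ->]]]]; [by left|right].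
  have hST : (mdegree h < (S + T).+1)%N by lia.
  by exists (l, mpoly.BMultinom hST).
by move=> le; have := count_exponents_gt0 m S; nia.
Qed.

(** Independent families have at most [n] members, so there is one of largest size [s >= r]; being
    largest, it is a basis. *)
Lemma dtrdeg_ge r (x : 'I_r -> U) :
  (forall i, dadjoin k (coords p) (x i)) -> dindep k x ->
  exists2 s, (r <= s)%N & dtrdeg_is k (dadjoin k (coords p)) s.
Proof.
move=> xE x_indep.
pose Q s := `[< exists y : 'I_s -> U,
  (forall i, dadjoin k (coords p) (y i)) /\ dindep k y >].
have Qr : Q r by apply/asboolP; exists x.
have Qn s : Q s -> (s <= n)%N by move=> /asboolP[y [yE /dindep_coords_le]]; exact.
have exQ : exists s, Q s by exists r.
case: (ex_maxnP exQ Qn) => s /asboolP[y [yE y_indep]] max.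
exists s; first exact: max.
exists y; split=> // u uE indep.
suff /max : Q s.+1 by rewrite ltnn.
(* [unlift ord0] identifies ['I_s.+1] with [option 'I_s], the index type used in [dtrans_basis]. *)
apply/asboolP; pose f (l : 'I_s.+1) := unlift ord0 l.
exists ((fun o => oapp y u o) \o f); split.
  by move=> l /=; case: (f l) => [j|] /=; [exact: yE|exact: uE].
apply: dindep_comp indep; first exact: diff_subfield_subfield.
by move=> a b; rewrite /f; case: unliftP => [a' ->|->]; case: unliftP => [b' ->|->] // [->].
Qed.

End TranscendenceBases.
End DifferentialClosure.

(** * Components, generic points and specialisation *)

Section Components.
Variables (m n : nat) (U : diffFieldType m) (k : set U).
Hypothesis hk : subfield k.
Implicit Types (V W X : set 'rV[U]_n) (p q : 'rV[U]_n) (P Q : dpoly U 'I_n).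

Definition zeros P : set 'rV[U]_n := [set y | deval idfun (y 0) P = 0].

(** This is the closure in the Kolchin topology over [k]. *)
Definition zariski_closure X : set 'rV[U]_n :=
  [set y | forall P, dpoly_over k P -> X `<=` zeros P -> zeros P y].

Lemma zariski_closure_variety X : diff_variety k (zariski_closure X).
Proof.
exists [set P | dpoly_over k P /\ X `<=` zeros P]; split=> [P []//|].
by apply/seteqP; split=> y yX P; [move=> [Pk XP]|move=> Pk XP]; exact: yX.
Qed.

Lemma sub_zariski_closure X : X `<=` zariski_closure X.
Proof. by move=> y Xy P _; exact. Qed.

Lemma zariski_closure_min X V : diff_variety k V -> X `<=` V -> zariski_closure X `<=` V.
Proof.
move=> [S [Sk ->]] XV y Xy P SP; apply: Xy; first exact: Sk.
by move=> x /XV; exact.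
Qed.

Lemma diff_varietyI V W : diff_variety k V -> diff_variety k W -> diff_variety k (V `&` W).
Proof.
move=> [S [Sk ->]] [T [Tk ->]]; exists (S `|` T); split=> [P []|]; [exact: Sk|exact: Tk|].
apply/seteqP; split=> y; first by move=> [Sy Ty] P [/Sy|/Ty].
by move=> STy; split=> P ?; apply: STy; [left|right].
Qed.

Lemma zeros_variety P : dpoly_over k P -> diff_variety k (zeros P).
Proof.
move=> Pk; exists [set P]; split=> [_ -> //|].
by apply/seteqP; split=> y; [move=> yP _ ->|exact].
Qed.

Lemma irreducible_sub W W1 W2 : diff_irreducible k W -> diff_variety k W1 ->
  diff_variety k W2 -> W `<=` W1 `|` W2 -> W `<=` W1 \/ W `<=` W2.
Proof.
move=> [Wv _ irr] W1v W2v WW.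
have [|||W1W|W2W] := irr (W `&` W1) (W `&` W2).
- exact: diff_varietyI.
- exact: diff_varietyI.
- by rewrite -setIUr; apply/esym/setIidPl.
- by left; apply/setIidPl.
- by right; apply/setIidPl.
Qed.

Lemma irreducible_closure X : X !=set0 ->
  (forall W1 W2, diff_variety k W1 -> diff_variety k W2 -> X `<=` W1 `|` W2 ->
     X `<=` W1 \/ X `<=` W2) ->
  diff_irreducible k (zariski_closure X).
Proof.
move=> [x Xx] irr; split; first exact: zariski_closure_variety.
  by exists x; exact: sub_zariski_closure.
move=> W1 W2 W1v W2v XW.
have [XW1|XW2] : X `<=` W1 \/ X `<=` W2.
  by apply: irr => //; rewrite -XW; exact: sub_zariski_closure.
- left; apply/seteqP; split; first exact: zariski_closure_min.
  by rewrite XW => y; left.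
- right; apply/seteqP; split; first exact: zariski_closure_min.
  by rewrite XW => y; right.
Qed.

(** Zorn's lemma on the irreducible varieties through [p] inside [V]; a nonempty chain is bounded by
    the closure of its union. *)
Lemma component_through V p : diff_variety k V -> V p ->
  exists2 W, diff_component k V W & W p.
Proof.
move=> Vv Vp.
pose good W := [/\ diff_irreducible k W, W `<=` V & W p].
pose R (A B : {W | good W}) := `[< sval A `<=` sval B >].
have [||||[W [Wirr WV Wp]] maxW] := @Zorn {W | good W} R.
- by move=> A; apply/asboolP.
- by move=> A B C /asboolP AB /asboolP BC; apply/asboolP; exact: subset_trans BC.
- by move=> [A gA] [B gB] /asboolP AB /asboolP BA; apply/eq_exist/seteqP.
- move=> C Ctot.
  have goodX X : X p -> X `<=` V ->
      (forall W1 W2, diff_variety k W1 -> diff_variety k W2 -> X `<=` W1 `|` W2 ->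
         X `<=` W1 \/ X `<=` W2) -> good (zariski_closure X).
    move=> Xp XV Xirr; split; last exact: sub_zariski_closure.
      by apply: irreducible_closure => //; exists p.
    exact: zariski_closure_min.
  (* The empty chain is bounded by the closure of the point [p]. *)
  have [C0|[A0 CA0]] : (forall A, ~ C A) \/ exists A, C A.
    have [h|h] := pselect (exists A, C A); [by right|left].
    by move=> A CA; apply: h; exists A.
    have gp : good (zariski_closure [set p]).
      apply: goodX => [//|_ -> //|W1 W2 _ _ /(_ p erefl)[pW|pW]]; [left|right];
        by move=> _ ->.
    by exists (exist _ _ gp) => A /C0.
  pose X := \bigcup_(A in C) sval A.
  have gX : good (zariski_closure X).
    apply: goodX.
    - by exists A0 => //; case: (svalP A0).
    - by move=> y [A _ Ay]; have [_ AV _] := svalP A; exact: AV.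
    - move=> W1 W2 W1v W2v XW.
      have sub A : C A -> sval A `<=` W1 \/ sval A `<=` W2.
        move=> CA; have [Airr _ _] := svalP A; apply: irreducible_sub => //.
        by move=> y Ay; apply: XW; exists A.
      (* A member [B] not inside [W1] lies inside [W2]. Members contained in [B] then do so too, and
         a member containing [B] cannot be inside [W1]. *)
      have [h|/existsNP[B /not_implyP[CB nBW1]]] :=
          pselect (forall A, C A -> sval A `<=` W1).
        by left=> y [A CA Ay]; exact: h Ay.
      right=> y [A CA Ay]; have [//|BW2] := sub B CB.
      have [/asboolP AB|/asboolP BA] := Ctot A B CA CB; first exact/BW2/AB.
      have [AW1|AW2] := sub A CA; last exact: AW2.
      by case: nBW1; exact: subset_trans AW1.
  exists (exist _ _ gX) => A CA; apply/asboolP => y Ay /=.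
  by apply: sub_zariski_closure; exists A.
exists W => //; split=> // W' W'irr WW' W'V.
have gW' : good W' by split=> //; exact: WW'.
by have /(_ _)/(congr1 sval) := maxW (exist _ _ gW'); apply; apply/asboolP.
Qed.

Lemma dpoly_overM P Q : dpoly_over k P -> dpoly_over k Q -> dpoly_over k (P * Q).
Proof.
move=> Pk Qk u; rewrite mcoeffMl; apply: (subfield_sum _ hk) => i _.
apply: (subfield_sum _ hk) => j _; rewrite -mulr_natr.
apply: (subfieldM hk); first exact: subfieldM.
by case: eqP => _; [exact: subfield1|exact: subfield0].
Qed.

(** By irreducibility, a product of finitely many polynomials none of which vanishes on all of [W]
    does not vanish on all of [W] either. *)
Lemma irreducible_nonzero_point W (t : seq (dpoly U 'I_n)) :
  diff_irreducible k W ->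
  (forall Q, Q \in t -> dpoly_over k Q /\ ~ W `<=` zeros Q) ->
  exists2 y, W y & forall Q, Q \in t -> deval idfun (y 0) Q != 0.
Proof.
move=> Wirr tP.
suff [Q [Qk WQ Qt]] : exists Q, [/\ dpoly_over k Q, ~ W `<=` zeros Q
    & forall y : 'rV[U]_n, deval idfun (y 0) Q != 0 ->
      forall Q', Q' \in t -> deval idfun (y 0) Q' != 0].
  have /existsNP[y /not_implyP[Wy /eqP yQ]] := WQ.
  by exists y => // Q'; exact: Qt.
elim: t tP => [|Q t IH] tP.
  exists 1; split=> [u||y _ Q //].
    by rewrite mcoeff1; case: eqP => _; [exact: subfield1|exact: subfield0].
  have [_ [y Wy] _] := Wirr; move=> /(_ _ Wy) /eqP.
  by rewrite /= devalE rmorph1 oner_eq0.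
have [Qk WQ] := tP Q (mem_head _ _).
have [|Q' [Q'k WQ' Q't]] := IH; first by move=> Q' Q't; apply: tP; rewrite inE Q't orbT.
have devM (y : 'rV[U]_n) : deval idfun (y 0) (Q * Q')
    = deval idfun (y 0) Q * deval idfun (y 0) Q' by rewrite !devalE rmorphM.
exists (Q * Q'); split; first exact: dpoly_overM.
- move=> WQQ'; have [|||//|//] := @irreducible_sub W (zeros Q) (zeros Q') Wirr.
  + exact: zeros_variety.
  + exact: zeros_variety.
  + move=> y /WQQ' /eqP; rewrite /= devM mulf_eq0 => /orP[/eqP|/eqP]; [by left|by right].
- move=> y; rewrite devM mulf_eq0 negb_or => /andP[yQ yQ'] R; rewrite inE => /predU1P[->//|].
  exact: Q't.
Qed.

(** A generic point realises the type asking that exactly the polynomials over [k] vanishing on [W]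
    be zero; [irreducible_nonzero_point] makes this type finitely satisfiable. *)
Lemma generic_point_exists (T : Type) W : (k #<= [set: T])%card ->
  diff_saturated U T -> diff_irreducible k W -> exists q, diff_generic k W q.
Proof.
move=> kT sat Wirr; have [[S [Sk WE]] _ _] := Wirr.
have [|||x [xS xN]] := sat k kT n
  [set P | dpoly_over k P /\ W `<=` zeros P] [set P | dpoly_over k P /\ ~ W `<=` zeros P].
- by move=> P [].
- by move=> P [].
- move=> s t sP tP; have [y Wy yt] := irreducible_nonzero_point Wirr tP.
  exists (y 0); split=> // P /sP[_ WP]; exact: WP.
- have rowE : (\row_i x i) 0 = x by apply: funext => i; rewrite mxE.
  exists (\row_i x i); split.
    rewrite WE => P SP /=; rewrite rowE; apply: xS; split; first exact: Sk.
    by move=> y; rewrite WE; exact.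
  rewrite rowE => P Pk xP y Wy; apply: contrapT => yP.
  have := xN P; rewrite xP eqxx => h; have // : false by apply: h; split=> // /(_ y Wy).
Qed.

End Components.

(** A relation at the generic point [q] holds throughout [W], in particular at [p]: specialisation
    cannot create independence. *)
Lemma generic_dindep m n (U : diffFieldType m) (k : set U) (W : set 'rV[U]_n)
    (p q : 'rV[U]_n) r (sigma : 'I_r -> 'I_n) :
  subfield k -> injective sigma -> diff_generic k W q -> W p ->
  dindep k (p 0 \o sigma) -> dindep k (q 0 \o sigma).
Proof.
move=> hk sigma_inj [_ Wq] Wp p_indep P Pk P0.
have [Q [Qk QE _]] := dpoly_rename hk sigma_inj Pk.
by apply: p_indep => //; rewrite -QE; apply: Wq => //; rewrite QE.
Qed.

(** * Counting kept derivatives and the final contradiction *)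

Lemma leading_choice m n (U : diffFieldType m) (p : 'I_n -> U) (k : set U) :
  exists (lead : 'I_n -> option (exponent m)) (T : nat), forall i,
    if lead i is Some g then (mdegree g <= T)%N /\ alg (lower p k i g T) (dm g (p i))
    else forall g, ~ leading p k i g.
Proof.
have /choice[lead /choice[t leadP]] : forall i, exists o, exists t,
    if o is Some g then (mdegree g <= t)%N /\ alg (lower p k i g t) (dm g (p i))
    else forall g, ~ leading p k i g.
  move=> i; have [[g lead_g]|nlead] := pselect (exists g, leading p k i g); last first.
    by exists None, 0%N => g ?; apply: nlead; exists g.
  have [t alg_t] := alg_lower_bounded lead_g.
  exists (Some g), (mdegree g + t)%N; split; first exact: leq_addr.
  by apply: algS alg_t; apply: lower_le; exact: leq_addl.
exists lead, (\sum_i t i)%N => i; have := leadP i; case: (lead i) => // g [gt alg_t].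
have tT : (t i <= \sum_i t i)%N by rewrite (bigD1 i) //= leq_addr.
by split; [exact: leq_trans gt tT|apply: algS alg_t; exact: lower_le].
Qed.

(** A coordinate with a leading exponent loses at least [count_exponents m S] derivatives by
    [count_not_multiples]. The additive form avoids truncated subtraction. *)
Lemma count_kept m n (lead : 'I_n -> option (exponent m)) T S B :
  (forall i g, lead i = Some g -> (mdegree g <= T)%N) -> (S + T <= B)%N ->
  (#|{: {i : 'I_n & {b : mpoly.bmultinom m B.+1 | kept lead i b}}}|
    + n * count_exponents m S
   <= n * count_exponents m B + #|[pred i | lead i == None]| * count_exponents m S)%N.
Proof.
move=> leadT STB; rewrite card_tagged sumnE big_map big_enum /=.
rewrite -[in (n * count_exponents m S)%N](card_ord n) -[in (n * count_exponents m B)%N](card_ord n).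
rewrite -!sum1_card !big_distrl /= [X in (_ <= _ + X)%N]big_mkcond /= -!big_split /=.
apply: leq_sum => i _; rewrite !mul1n card_sig /= inE.
have := leadT i; rewrite /kept; case: (lead i) => [g|] leg /=.
  by rewrite addn0; exact: count_not_multiples (leg g erefl) STB.
by rewrite leq_add2r; exact: max_card.
Qed.

Theorem theorem5p1 (m n d : nat) (K U : diffFieldType m)
    (iota : {rmorphism K -> U}) (K_char0 : [pchar K] =i pred0)
    (iota_diff : diff_morphism iota)
    (U_closed : diff_closed U) (U_large : diff_saturated U K)
    (V : set 'rV[U]_n) (V_var : diff_variety (range iota) V)
    (V_dim : diff_dim_is (range iota) V d)
    (a : 'rV[U]_n) (c : 'M[U]_(d.+1, n))
    (c_indep : dindep (dadjoin (range iota) (coords a))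
                 (fun ji : 'I_d.+1 * 'I_n => c ji.1 ji.2)) :
  V `&` (\bigcap_(j in [set: 'I_d.+1]) hyperplane_through a (row j c)) !=set0 ->
  V a.
Proof.
move=> [p [Vp Hp]]; have [<- //|pa] := eqVneq p a.
have [i0 pa0] : exists i, p 0 i != a 0 i.
  apply/existsP; rewrite -negb_forall; apply: contra pa => /forallP pa.
  by apply/eqP/rowP => i; exact/eqP.
exfalso; move: c_indep V_var V_dim; set k := range iota => c_indep V_var [_ V_dim].
have hk : diff_subfield k.
  split=> [|_ _ [x _ <-] [y _ <-]|_ _ [x _ <-] [y _ <-]|_ [x _ <-]|i _ [x _ <-]].
  - by exists 1; rewrite ?rmorph1.
  - by exists (x - y); rewrite ?rmorphB.
  - by exists (x * y); rewrite ?rmorphM.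
  - by exists x^-1; rewrite ?fmorphV.
  - by exists (der i x).
have hk' := diff_subfield_subfield hk.
have char0 : [pchar U] =i pred0 by move=> q; rewrite (fmorph_pchar iota) K_char0.
have [W Wcomp Wp] := component_through V_var Vp.
have [q Wq] : exists q, diff_generic k W q.
  apply: (generic_point_exists hk' _ U_large); last by case: Wcomp.
  exact: card_image_le.
have [lead [T leadP]] := leading_choice (p 0) k.
pose J := [pred i | lead i == None].
have J_le : (#|J| <= d)%N.
  pose sigma (l : 'I_#|J|) := enum_val l.
  have sigma_inj : injective sigma by exact: enum_val_inj.
  have [||s Js s_deg] := @dtrdeg_ge m U n k hk q #|J| (q 0 \o sigma).
  - by move=> l; apply: sub_dadjoin; right; exists (sigma l).
  - apply: generic_dindep Wq Wp _ => //; apply: non_leading_dindep => // l.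
    by have := leadP (sigma l); have /eqP -> := enum_valP l.
  - exact: leq_trans Js (V_dim _ _ _ Wcomp Wq s_deg).
have leadT i g : lead i = Some g ->
    (mdegree g <= T)%N /\ alg (lower (p 0) k i g T) (dm g (p 0 i)).
  by move=> lead_i; have := leadP i; rewrite lead_i.
(* The shift [n * T] covers the rise in order allowed by [kept_cover], and the factor [n] the number
   of coordinates of [p]. *)
have [S growth] := count_exponents_growth m n (n * T).
set F := dadjoin k (coords a) in c_indep *.
have hF : diff_subfield F by exact: dadjoin_diff_subfield.
have hF' := diff_subfield_subfield hF.
have kF : k `<=` F by move=> x kx; apply: sub_dadjoin; left.
pose L := ('I_d.+1 * {i : 'I_n | i != i0})%type.
pose kept_type := {i : 'I_n & {b : mpoly.bmultinom m (S + n * T).+1 | kept lead i b}}.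
(* The generators over [F]: the derivatives up to order [S] of the coefficients off column [i0], and
   the kept derivatives of [p] up to order [S + n * T]. *)
pose w (x : L * mpoly.bmultinom m S.+1 + kept_type) : U := match x with
  | inl x => dm x.2 (c x.1.1 (val x.1.2))
  | inr x => dm (val (tagged x)) (p 0 (tag x))
  end.
have p_alg i g : (mdegree g <= S)%N -> alg (fgen (F `|` range w)) (dm g (p 0 i)).
  move=> gS; have giS : (mdegree g <= S + (n - i) * T)%N by exact: leq_trans gS (leq_addr _ _).
  have := kept_cover char0 (@dsub_der _ _ _ hk) leadT giS.
  apply: algS; apply: fgenS => x [kx|[i' [h [kept_h hB ->]]]]; [by left; exact: kF|right].
  have hB' : (mdegree h < (S + n * T).+1)%N by [].
  by exists (inr (Tagged _ (exist _ (mpoly.BMultinom hB') kept_h))).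
have c_alg ji g : (mdegree g <= S)%N ->
    alg (fgen (F `|` range w)) (dm g (c ji.1 ji.2)).
  case: ji => j i gS /=; have [->|ii0] := eqVneq i i0; last first.
    apply: (sub_alg (fgen_subfield _)); apply: sub_fgen; right.
    have gS' : (mdegree g < S.+1)%N by [].
    by exists (inl (j, exist _ i ii0, mpoly.BMultinom gS')).
  pose y (l : L + 'I_n) := match l with
    | inl l => c l.1 (val l.2) | inr i => p 0 i end.
  (* Solving the hyperplane equation expresses [c j i0] at level 0 of the filtration, so its
     derivatives up to order [S] involve the other data only up to order [S]. *)
  have cy : dgen F y 0 (c j i0).
    have gen := @fgen_subfield U (F `|` [set x | exists l h, (mdegree h <= 0)%N /\ x = dm h (y l)]).
    have gen_a l : dgen F y 0 (a 0 l).
      by apply: sub_fgen; left; apply: sub_dadjoin; right; exists l.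
    have gen_y l : dgen F y 0 (y l).
      apply: sub_fgen; right; exists l, mpoly.mnm0.
      by rewrite mpoly.mdeg0 dm0.
    have gen_p l : dgen F y 0 (p 0 l) by exact: (gen_y (inr l)).
    have := Hp j I; rewrite /hyperplane_through /= (bigD1 i0) //= mxE => /eqP.
    rewrite addr_eq0 => /eqP cE.
    have pa0' : p 0 i0 - a 0 i0 != 0 by rewrite subr_eq0.
    rewrite -[c j i0](mulfK pa0') cE; apply: (subfieldM gen); last first.
      by apply: (subfieldV gen); apply: (subfieldB gen); [exact: gen_p|exact: gen_a].
    apply: (subfieldN gen); apply: (subfield_sum _ gen) => l li0.
    rewrite mxE; apply: (subfieldM gen); last first.
      by apply: (subfieldB gen); [exact: gen_p|exact: gen_a].
    exact: (gen_y (inl (j, exist _ l li0))).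
  have := @dm_dgen m U F _ y 0 g _ hF cy; apply: fgen_min.
    by apply: alg_subfield; exact: fgen_subfield.
  move=> x [Fx|[l [h [hg ->]]]].
    by apply: (sub_alg (fgen_subfield _)); apply: sub_fgen; left.
  have hS : (mdegree h < S.+1)%N by lia.
  case: l => [l|l] /=; last exact: p_alg.
  apply: (sub_alg (fgen_subfield _)); apply: sub_fgen; right.
  by exists (inl (l, mpoly.BMultinom hS)).
have := dindep_bound hF' c_indep c_alg.
rewrite card_sum !card_prod card_sig !card_ord -/(count_exponents m S).
have -> : #|[pred i | i != i0]| = n.-1 by have := cardC1 i0; rewrite card_ord.
have STB : (S + T <= S + n * T)%N.
  by rewrite leq_add2l leq_pmull // (leq_ltn_trans _ (ltn_ord i0)).
have := count_kept (fun i g h => proj1 (leadT i g h)) STB; rewrite -/J -/kept_type.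
have n0 : (0 < n)%N by exact: leq_ltn_trans (ltn_ord i0).
have := count_exponents_gt0 m S.
(* Independence gives [d.+1 * N <= M], with [M] the number of kept derivatives. But [M + n * N <= n
   * NB + r * N < n.+1 * N + r * N], so [M < r.+1 * N], against [r <= d]. *)
move: (count_exponents m S) (count_exponents m (S + n * T)) #|J| J_le #|{: kept_type}| growth.
move=> N NB r rd M; case: (n) n0 => // n' _; rewrite /= !mulnS => growth N0.
have rN : (r * N <= d * N)%N by rewrite leq_mul2r rd orbT.
rewrite !mulnDl !mulSn; lia.
Qed.
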